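(* Let $\sigma\in\mathcal{M}^{+}(\mathbb{R}^n)$, $0<q<r<\infty$ and $0<\tau<\infty$. Then there exists a positive constant $C$ depending only on $r$, $q$ and $\tau$ such that, for every sequence $\Lambda=(\lambda_Q)_{Q\in\mathcal{Q}}$ of nonnegative reals, $$\frac{1}{C}\,a_2(\Lambda)\le a_1(\Lambda)\le C\,a_2(\Lambda),$$ where $$a_1(\Lambda)=\int_{\mathbb{R}^n}\Big(\sum_{Q\in\mathcal{D}}\lambda_Q\chi_Q\Big)^r d\sigma,$$ $$a_2(\Lambda)=\int_{\mathbb{R}^n}\Big[\sum_{R\in\mathcal{D}}\lambda_R\chi_R\Big(\frac{1}{|R|_\sigma}\int_R\Big(\sum_{Q\subseteq R}\lambda_Q\chi_Q\Big)^q d\sigma\Big)^{\frac1q(\frac r\tau-1)}\Big]^\tau d\sigma.$$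
   Context: $\mathcal{M}^{+}(\mathbb{R}^n)$ is the class of locally finite (nonnegative) Borel measures on $\mathbb{R}^n$; $|E|_\sigma=\sigma(E)$ for Borel sets $E$; $\chi_E$ is the characteristic function of $E$; $\mathcal{Q}$ is the family of all dyadic cubes in $\mathbb{R}^n$, and $\mathcal{D}$ is the collection of all $Q\in\mathcal{Q}$ with $|Q|_\sigma\ne 0$. Sums over $Q\subseteq R$ are over $Q\in\mathcal{D}$ with $Q\subseteq R$. Terms with $\lambda_R=0$ in the sum over $R$ are zero.
   Formalization: When τ > r, the negative power of an infinite average over R is taken to be +∞ (with the value 0 the claim fails, e.g. for a Dirac mass at 0 and λ_Q = 1 on the dyadic cubes containing 0). *)

(* Defs.v *)
From HB Require Import structures.
From mathcomp Require Import all_boot all_order all_algebra.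
From mathcomp Require Import all_classical all_reals all_analysis.
Import Order.TTheory GRing.Theory Num.Theory.
Import numFieldNormedType.Exports.

Set Implicit Arguments.
Unset Strict Implicit.
Unset Printing Implicit Defensive.

Local Open Scope classical_set_scope.
Local Open Scope ring_scope.

Definition borelRn (R : realType) (n : nat) :=
  g_sigma_algebraType (@open 'rV[R]_n).

Definition locally_finite (R : realType) (n : nat)
    (sigma : {measure set (borelRn R n) -> \bar R}) : Prop :=
  forall x : 'rV[R]_n,
    exists2 U : set 'rV[R]_n, open_nbhs x U & (sigma U < +oo)%E.

(* The half-open cube 2^-k (m + [0, 1[^n). *)
Definition dyadic_cube (R : realType) (n : nat) (k : int) (m : 'rV[int]_n) :
    set (borelRn R n) :=
  [set x : 'rV[R]_n | forall i : 'I_n,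
     (m ord0 i)%:~R * 2 ^ (- k) <= x ord0 i < (m ord0 i + 1)%:~R * 2 ^ (- k)].

Definition dyadic_cubes (R : realType) (n : nat) : set (set (borelRn R n)) :=
  [set Q | exists k m, Q = dyadic_cube k m].

Section DyadicSums.
Context (R : realType) (n : nat).
Variable sigma : {measure set (borelRn R n) -> \bar R}.

Definition charged_cubes : set (set (borelRn R n)) :=
  [set Q | dyadic_cubes Q /\ sigma Q != 0%E].

Local Open Scope ereal_scope.

(* Only the values of lam on dyadic cubes matter. *)
Variable lam : set (borelRn R n) -> R.

Definition dyadic_sum (x : borelRn R n) : \bar R :=
  \esum_(Q in charged_cubes) (lam Q * \1_Q x)%:E.

Definition local_dyadic_sum (P : set (borelRn R n)) (x : borelRn R n) :
    \bar R :=
  \esum_(Q in charged_cubes `&` [set Q | Q `<=` P]) (lam Q * \1_Q x)%:E.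

Definition average_pow (q : R) (P : set (borelRn R n)) : \bar R :=
  (sigma P)^-1 * \int[sigma]_(x in P) (local_dyadic_sum P x `^ q).

Definition a1 (r : R) : \bar R := \int[sigma]_x (dyadic_sum x `^ r).

(* As 0 * +oo = 0, the terms with lam P = 0 vanish; if 0 < lam P then the
   average is positive. A negative power of an infinite average, which can
   occur only for r < tau, is +oo (poweRyr), so that a2 is infinite as soon as
   0 < lam P for some P with infinite average; a1 is then infinite too by
   Jensen's inequality. With the value 0 instead, a1 could not be bounded by
   a2: for the Dirac mass at 0 and lam equal to 1 on the cubes containing 0,
   a1 is infinite, whereas a2 would be 0. *)
Definition a2 (q r tau : R) : \bar R :=
  \int[sigma]_x
    ((\esum_(P in charged_cubes)
        ((lam P * \1_P x)%:E
         * average_pow q P `^ (q^-1 * (r / tau - 1))%R)) `^ tau).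

End DyadicSums.

(* Main.v *)
Require Import Defs.
From mathcomp Require Import all_boot all_order all_algebra.
From mathcomp Require Import all_classical all_reals all_analysis.
From mathcomp Require Import ring lra.
From mathcomp Require Import measurable_realfun.
Import Order.TTheory GRing.Theory Num.Theory.
Import numFieldNormedType.Exports.
Local Open Scope classical_set_scope.
Local Open Scope ring_scope.

(* Write [s = r / tau - 1], [f_Q] for the sum of the [lam] over the cubes below
   [Q] and [A_Q] for the [q]-average of [f_Q] on [Q], so that [a1] is the
   integral of [f ^ r], [a2] that of [G ^ tau] with [G] the sum of the
   [lam_Q A_Q ^ s], and [A_Q] is at most the maximal function
   [A = (M (f ^ q)) ^ (1/q)] on [Q]. Only the tree structure of the dyadic
   cubes matters, and for [s = 0] there is nothing to prove. At each point,
   summation by parts gives [f ^ (1 + s) ~ \sum_Q lam_Q f_Q ^ s], and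
   [r = (1 + s) tau].
   - Two bounds ([a1 <= C a2] if [s > 0], [a2 <= C a1] if [s < 0]): [f_Q] is at
     most a multiple of [A_Q] on at least half of [Q], and the integral of a
     power of [\sum_Q c_Q 1_Q] is comparable with the one obtained when each
     [Q] is replaced by such a half.
   - If [s > 0], then [G <= f A ^ s], and [a2 <= C a1] follows from the maximal
     theorem with exponent [r / q > 1].
   - If [s < 0], then [f <= G A ^ (- s)], and [a1 <= C a2] follows once the
     integral of [A ^ r] is bounded by that of [G ^ tau]. This is done without
     assuming that [a1] is finite: for some [t < tau], the power
     [A_Q ^ (r t / tau)] is at most a multiple of the average of [G ^ t] on [Q],
     to which the maximal theorem with exponent [tau / t > 1] applies. *)

Set Implicit Arguments.
Unset Strict Implicit.
Unset Printing Implicit Defensive.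

(** * Power inequalities *)

Lemma powR_weighted_amgm (R : realType) (a b t : R) :
  0 <= a -> 0 <= b -> 0 < t < 1 ->
  a `^ t * b `^ (1 - t) <= t * a + (1 - t) * b.
Proof.
move=> a0 b0 /andP[t0 t1].
have t1' : 0 < 1 - t by rewrite subr_gt0.
have := @conjugate_powR R (a `^ t) (b `^ (1 - t)) t^-1 (1 - t)^-1
  (powR_ge0 _ _) (powR_ge0 _ _).
rewrite -!powRrM !divff ?gt_eqF// !powRr1// !invrK !invr_gt0.
by rewrite (mulrC a) (mulrC b); apply => //; lra.
Qed.

Lemma powR_mulDB1 (R : realType) (a p : R) :
  0 <= a -> p != 0 -> a * a `^ (p - 1) = a `^ p.
Proof.
rewrite le_eqVlt => /predU1P[<-|a0] p0; first by rewrite mul0r powR0.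
by rewrite -{1}(powRr1 (ltW a0)) -powRD ?subrKC// (gt_eqF a0) implybT.
Qed.

Lemma powR_antitone (R : realType) (a b p : R) :
  0 < a -> a <= b -> p <= 0 -> b `^ p <= a `^ p.
Proof.
move=> a0 ab p0; have b0 := lt_le_trans a0 ab.
rewrite -[p]opprK !(powRN _ (- p)) lef_pV2 ?posrE ?powR_gt0//.
by apply: ge0_ler_powR; rewrite ?oppr_ge0// nnegrE ltW.
Qed.

(** A mean value bound with the derivative taken at the larger point. For [p > 1] it is Young's
    inequality for [b * a ^ (p - 1)]; for [p < 1] it follows from [b ^ p >= b * a ^ (p - 1)]. The
    factor [1 + p] covers both. *)
Lemma powR_increment_le (R : realType) (a b p : R) : 0 < p -> 0 <= b <= a ->
  a `^ p - b `^ p <= (1 + p) * ((a - b) * a `^ (p - 1)).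
Proof.
move=> p0 /andP[b0 ba]; have a0 := le_trans b0 ba.
have ab0 : 0 <= (a - b) * a `^ (p - 1).
  by rewrite mulr_ge0 ?powR_ge0// subr_ge0.
have aE := @powR_mulDB1 R a p a0 (lt0r_neq0 p0).
have [p1|p1|p1] := ltgtP p 1; last first.
- by rewrite p1 subrr !powRr0 !powRr1// in ab0 *; nra.
- have := @powR_weighted_amgm R (b `^ p) (a `^ p) p^-1
    (powR_ge0 _ _) (powR_ge0 _ _).
  rewrite invr_gt0 p0 invf_lt1// p1 -!powRrM divff ?gt_eqF// powRr1// => /(_ isT).
  rewrite mulrBr mulr1 divff ?gt_eqF// => /(ler_wpM2l (ltW p0)).
  rewrite mulrDr !mulrA mulrBr divff ?gt_eqF// mulr1 => H.
  by nra.
- have [b1|b1] := ltrP 0 b; last first.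
    have -> : b = 0 by apply/eqP; rewrite eq_le b1.
    by rewrite powR0 ?gt_eqF// !subr0 aE; have := powR_ge0 a p; nra.
  have := @powR_antitone R b a (p - 1) b1 ba.
  move=> /(_ _)/(ler_wpM2l b0); rewrite (@powR_mulDB1 R b p)// ?gt_eqF// => H.
  have /H : p - 1 <= 0 by lra.
  by nra.
Qed.

(** The two cases change places: monotonicity of the power serves [p > 1], the weighted inequality
    for [b ^ p * a ^ (1 - p)] serves [p < 1]. *)
Lemma powR_increment_ge (R : realType) (a b p : R) : 0 < p -> 0 <= b <= a ->
  (a - b) * a `^ (p - 1) <= (1 + p^-1) * (a `^ p - b `^ p).
Proof.
move=> p0 /andP[b0 ba]; have a0 := le_trans b0 ba.
have ab0 : 0 <= a `^ p - b `^ p by rewrite subr_ge0 ge0_ler_powR// ltW.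
have aE := @powR_mulDB1 R a p a0 (lt0r_neq0 p0).
have pV0 : 0 < p^-1 by rewrite invr_gt0.
have [p1|p1|p1] := ltgtP p 1; last first.
- by rewrite p1 subrr !powRr0 !powRr1// in ab0 *; nra.
- have : b `^ (p - 1) <= a `^ (p - 1).
    by rewrite ge0_ler_powR// subr_ge0 ltW.
  move=> /(ler_wpM2l b0); rewrite (@powR_mulDB1 R b p)// ?gt_eqF// => H.
  by nra.
- have [/eqP a1|a1] := boolP (a == 0).
    have b1 : b = 0 by apply/eqP; rewrite eq_le b0 -a1 ba.
    by rewrite a1 b1 subrr mul0r subrr mulr0.
  have := @powR_weighted_amgm R b a p b0 a0; rewrite p0 p1 => /(_ isT).
  have a2 : 0 < a by rewrite lt_neqAle eq_sym a1.
  have aK : a `^ (p - 1) * a `^ (1 - p) = 1.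
    by rewrite -powRD ?a1 ?implybT// addrC subrKA subrr powRr0.
  have h0 := powR_ge0 a (p - 1).
  move=> /(ler_wpM2l h0); rewrite mulrCA aK mulr1 => H.
  have H1 : p * ((a - b) * a `^ (p - 1)) <= a `^ p - b `^ p by nra.
  have : (a - b) * a `^ (p - 1) <= p^-1 * (a `^ p - b `^ p).
    by rewrite ler_pdivlMl.
  by nra.
Qed.

(** With [Phi] the power [p] and [Psi] a multiple of the power [p - 1], this is the increment
    condition of [chain_max_le]. Both sides are compared with [(a - b) * a ^ (p - 1)]. *)
Lemma powR_increment_doob (R : realType) (a b p : R) : 1 < p -> 0 <= b <= a ->
  a `^ p - b `^ p <=
  (1 + p) * (1 + (p - 1)^-1) * (a * (a `^ (p - 1) - b `^ (p - 1))).
Proof.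
move=> p1 ab; have /andP[b0 ba] := ab; have a0 := le_trans b0 ba.
have q0 : 0 < p - 1 by rewrite subr_gt0.
apply: (le_trans (@powR_increment_le R a b p (lt_trans ltr01 p1) ab)).
rewrite -!mulrA ler_pM2l; last by lra.
rewrite -(@powR_mulDB1 R a (p - 1))// ?gt_eqF// mulrCA [leRHS]mulrCA.
rewrite ler_wpM2l// (powR_mulDB1 a0) ?gt_eqF//.
exact: powR_increment_ge.
Qed.

(** The analogue for [k < 1]: the power [k - 1] decreases, so [Psi] is minus a multiple of it and
    hence bounded above. That bound later takes the place of absorption. *)
Lemma powR_increment_kolmogorov (R : realType) (a b k : R) :
  0 < k < 1 -> 0 < b <= a ->
  a `^ k - b `^ k <=
  (1 + k) * (1 + (1 - k)^-1) * (a * (b `^ (k - 1) - a `^ (k - 1))).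
Proof.
move=> /andP[k0 k1] /andP[b0 ba]; have a0 := lt_le_trans b0 ba.
have q0 : 0 < 1 - k by rewrite subr_gt0.
have ab : 0 <= b <= a by rewrite ltW.
apply: (le_trans (@powR_increment_le R a b k k0 ab)).
rewrite -!mulrA ler_pM2l; last by lra.
have := @powR_increment_ge R a b (1 - k) q0 ab.
rewrite -(opprB 1 k) !powRN.
set A := a `^ (1 - k); set B := b `^ (1 - k).
have A0 : 0 < A by rewrite powR_gt0.
have B0 : 0 < B by rewrite powR_gt0.
have BA : B <= A by rewrite ge0_ler_powR ?nnegrE// ltW.
have -> : a `^ (1 - k - 1) = A / a.
  by rewrite powRD ?(gt_eqF a0) ?implybT// powR_inv1// ltW.
move=> H; have -> : B^-1 - A^-1 = (A - B) / (A * B) by field; rewrite !gt_eqF.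
have K0 : 0 <= 1 + (1 - k)^-1 by rewrite addr_ge0// invr_ge0 ltW.
have -> : (a - b) / A = (a - b) * (A / a) * (a / A ^+ 2).
  by field; rewrite !gt_eqF.
have aA : 0 <= a / A ^+ 2 by rewrite divr_ge0 ?sqr_ge0// ltW.
apply: (le_trans (ler_wpM2r aA H)).
rewrite -mulrA ler_wpM2l//.
have -> : (A - B) * (a / A ^+ 2) = a * (A - B) * A ^- 2 by ring.
rewrite (mulrA a) ler_wpM2l ?mulr_ge0 ?subr_ge0 ?(ltW a0)//.
by rewrite lef_pV2 ?posrE ?exprn_gt0 ?mulr_gt0// expr2 ler_pM2l.
Qed.

(** According to which of [a] and [e ^ (1 / t) * b] is larger, one of the two terms on the right
    already dominates. The free [e] lets the second term be made small enough to absorb. *)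
Lemma powR_young_eps (R : realType) (a b t e : R) :
  0 <= a -> 0 <= b -> 0 < t < 1 -> 0 < e ->
  a `^ t * b `^ (1 - t) <= e `^ (- ((1 - t) / t)) * a + e * b.
Proof.
move=> a0 b0 /andP[t0 t1] e0.
have t1' : 0 < 1 - t by rewrite subr_gt0.
have split c : 0 <= c -> c `^ t * c `^ (1 - t) = c.
  by move=> c0; rewrite -powRD ?subrKC ?powRr1// oner_eq0.
have [le|lt] := lerP a (e `^ t^-1 * b).
  apply: (@le_trans _ _ (e * b)); last by rewrite lerDr mulr_ge0 ?powR_ge0.
  rewrite -{2}(split b b0) mulrA ler_wpM2r ?powR_ge0//.
  have := @ge0_ler_powR R t (ltW t0) a (e `^ t^-1 * b).
  rewrite !nnegrE a0 mulr_ge0 ?powR_ge0// => /(_ isT isT le).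
  by rewrite powRM ?powR_ge0// -powRrM mulVf ?gt_eqF// powRr1// ltW.
apply: (@le_trans _ _ (e `^ (- ((1 - t) / t)) * a)); last first.
  by rewrite lerDl mulr_ge0// ltW.
have le' : b <= e `^ (- t^-1) * a.
  by rewrite powRN mulrC ler_pdivlMr ?powR_gt0// mulrC ltW.
have -> : e `^ (- ((1 - t) / t)) = (e `^ (- t^-1)) `^ (1 - t).
  by rewrite -powRrM; congr (_ `^ _); ring.
rewrite -{2}(split a a0) mulrCA ler_wpM2l ?powR_ge0//.
rewrite -powRM ?powR_ge0// ge0_ler_powR ?nnegrE ?mulr_ge0 ?powR_ge0//.
exact: ltW.
Qed.

Lemma powR_mul_le (R : realType) (a b p t : R) :
  0 <= a -> 0 <= b -> 0 < t < p ->
  a `^ t * b `^ (p - t) <= a `^ p + b `^ p.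
Proof.
move=> a0 b0 /andP[t0 tp].
have p0 := lt_trans t0 tp.
have := @powR_weighted_amgm R (a `^ p) (b `^ p) (t / p)
  (powR_ge0 _ _) (powR_ge0 _ _).
rewrite divr_gt0// ltr_pdivrMr// mul1r tp -!powRrM => /(_ isT).
have -> : p * (t / p) = t by field; rewrite gt_eqF.
have -> : p * (1 - t / p) = p - t by field; rewrite gt_eqF.
move=> /le_trans; apply.
have h1 : 0 < t / p by rewrite divr_gt0.
have h2 : t / p < 1 by rewrite ltr_pdivrMr// mul1r.
have := powR_ge0 a p; have := powR_ge0 b p; nra.
Qed.

(** * Sums along a chain *)

(** By induction on the cardinality, removing the element [t] of highest level: its closed segment
    is all of [A] and, levels being distinct, its open one is [A] without [t]. *)
Lemma chain_telescope (I : finType) (V : zmodType) (lev : I -> int)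
    (T : {set I} -> V) (A : {set I}) : {in A &, injective lev} ->
  \sum_(i in A) (T [set j in A | lev j <= lev i]%SET
                 - T [set j in A | lev j < lev i]%SET) = T A - T finset.set0.
Proof.
elim: {A}#|A| {-2}A (erefl #|A|) => [|N IH] A cardA injA.
  by move/eqP: cardA; rewrite cards_eq0 => /eqP ->; rewrite big_set0 subrr.
have [i0 i0A] : exists i0, i0 \in A by apply/set0Pn; rewrite -cards_eq0 cardA.
have [t tA tmax] := @arg_maxP _ _ I i0 (mem A) lev i0A.
have {}tmax j : j \in A -> lev j <= lev t by move=> /tmax.
have tlt j : j \in A -> j != t -> lev j < lev t.
  move=> jA jt; rewrite lt_neqAle tmax// andbT.
  by apply: contraNneq jt => /injA -> //.
rewrite (bigD1 t)//=.
have -> : [set j in A | lev j <= lev t]%SET = A.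
  by apply/setP => j; rewrite inE; case: (boolP (j \in A)) => // /tmax.
have -> : [set j in A | lev j < lev t]%SET = (A :\ t)%SET.
  apply/setP => j; rewrite !inE andbC.
  have [->|jt] := eqVneq j t; first by rewrite ltxx.
  by case: (boolP (j \in A)) => [/tlt ->//|]; rewrite ?andbF.
have := IH (A :\ t)%SET; rewrite (cardsD1 t A) (tA : t \in A) in cardA.
move=> /(_ (succn_inj cardA)) {}IH.
have {}IH := IH (fun i j iA jA => injA i j (fintype.subsetP (subD1set A t) i iA)
  (fintype.subsetP (subD1set A t) j jA)).
(* The segments of the other elements do not contain [t], so they are the same in [A] and in [A]
   without [t]. *)
have E (op : rel int) i : (forall x y, op x y -> x <= y) -> i \in (A :\ t)%SET ->
    [set j in A | op (lev j) (lev i)]%SET =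
    [set j in (A :\ t)%SET | op (lev j) (lev i)]%SET.
  move=> opW /setD1P[it iA]; apply/setP => j; rewrite !inE.
  have [->|//] := eqVneq j t.
  by apply/negbTE/negP => /andP[_ /opW]; rewrite leNgt tlt.
rewrite [X in _ + X](eq_bigl (fun i => i \in (A :\ t)%SET)); last first.
  by move=> i; rewrite !inE andbC.
rewrite [X in _ + X](eq_bigr (fun i =>
    T [set j in (A :\ t)%SET | lev j <= lev i]%SET -
    T [set j in (A :\ t)%SET | lev j < lev i]%SET)); last first.
  by move=> i iA; rewrite -(E <=%R)// -(E <%R)// => x y /ltW.
by rewrite IH addrA subrK.
Qed.

Definition max_over (R : realType) (I : finType) (a : I -> R) (b0 : R)
  (B : {set I}) : R := \big[Num.max/b0]_(j in B) a j.

Section chain_sums.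
Context (R : realType) (I : finType) (lev : I -> int) (A : {set I}).
Hypothesis lev_inj : {in A &, injective lev}.

Let leS i := [set j in A | lev j <= lev i]%SET.
Let ltS i := [set j in A | lev j < lev i]%SET.

Let leSE i : i \in A -> leS i = (i |: ltS i)%SET.
Proof.
move=> iA; apply/setP => j; rewrite !inE le_eqVlt.
have [->|ji] := eqVneq j i; first by rewrite iA eqxx.
have [jA|//] := boolP (j \in A).
have [/(lev_inj jA iA) H|//] := eqVneq (lev j) (lev i).
by rewrite H eqxx in ji.
Qed.

Let ltSN i : i \notin ltS i.
Proof. by rewrite inE ltxx andbF. Qed.

Let big_leS (F : I -> R) i :
  \sum_(j in A | lev j <= lev i) F j = \sum_(j in leS i) F j.
Proof. by apply: eq_bigl => j; rewrite inE. Qed.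

(** Summation by parts: the power of the full sum telescopes over initial segments, and each
    increment is estimated by [powR_increment_le]. It is used with [lev] for sums over larger sets
    and with [- lev] for sums over smaller ones. *)
Lemma chain_powR_le (c : I -> R) (p : R) :
  0 < p -> (forall i, 0 <= c i) ->
  (\sum_(i in A) c i) `^ p <=
  (1 + p) *
  \sum_(i in A) c i * (\sum_(j in A | lev j <= lev i) c j) `^ (p - 1).
Proof.
move=> p0 c0.
have := chain_telescope (fun B : {set I} => (\sum_(j in B) c j) `^ p) lev_inj.
rewrite big_set0 powR0 ?gt_eqF// subr0 => <-.
rewrite mulr_sumr ler_sum// => i iA.
rewrite big_leS (_ : [set j in A | _]%SET = leS i)//.
rewrite (_ : [set j in A | lev j < _]%SET = ltS i)// leSE// big_setU1//=.
set b := \sum_(j in ltS i) c j.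
have b0 : 0 <= b by exact: sumr_ge0.
have := @powR_increment_le R (c i + b) b p p0.
by rewrite addrK b0 lerDr c0; apply.
Qed.

Lemma chain_powR_ge (c : I -> R) (p : R) :
  0 < p -> (forall i, 0 <= c i) ->
  \sum_(i in A) c i * (\sum_(j in A | lev j <= lev i) c j) `^ (p - 1) <=
  (1 + p^-1) * (\sum_(i in A) c i) `^ p.
Proof.
move=> p0 c0.
have := chain_telescope (fun B : {set I} => (\sum_(j in B) c j) `^ p) lev_inj.
rewrite big_set0 powR0 ?gt_eqF// subr0 => <-.
rewrite mulr_sumr ler_sum// => i iA.
rewrite big_leS (_ : [set j in A | _]%SET = leS i)//.
rewrite (_ : [set j in A | lev j < _]%SET = ltS i)// leSE// big_setU1//=.
set b := \sum_(j in ltS i) c j.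
have b0 : 0 <= b by exact: sumr_ge0.
have := @powR_increment_ge R (c i + b) b p p0.
by rewrite addrK b0 lerDr c0; apply.
Qed.

(* The increment of [Psi] at [i] vanishes unless [a i] is a new maximum. *)
Lemma chain_max_le (a : I -> R) (b0 : R) (Phi Psi : R -> R) :
  (forall x y, b0 <= y <= x -> Phi x - Phi y <= x * (Psi x - Psi y)) ->
  Phi (max_over a b0 A) - Phi b0 <=
  \sum_(i in A) a i *
    (Psi (max_over a b0 [set j in A | lev j <= lev i]%SET)
     - Psi (max_over a b0 [set j in A | lev j < lev i]%SET)).
Proof.
move=> H; pose M := max_over a b0.
have := chain_telescope (fun B : {set I} => Phi (M B)) lev_inj.
have M0 : M finset.set0 = b0 by rewrite /M /max_over big_set0.
rewrite M0 => <-.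
rewrite -/M ler_sum// => i iA.
rewrite (_ : [set j in A | _]%SET = leS i)//.
rewrite (_ : [set j in A | lev j < _]%SET = ltS i)//.
have -> : M (leS i) = Num.max (a i) (M (ltS i)).
  rewrite /M /max_over (bigmaxD1 i) ?leSE ?setU11//; congr (Num.max _ _).
  apply: eq_bigl => j; rewrite !inE.
  by have [->|] := eqVneq j i; rewrite ?ltxx ?andbF// orFb andbT.
have [le|lt] := lerP (a i) (M (ltS i)); first by rewrite !subrr mulr0.
by apply: H; rewrite (ltW lt) andbT bigmax_ge_id.
Qed.

End chain_sums.

(** * Finite families of sets *)

Definition members (T : Type) (I : finType) (E : I -> set T) (x : T) :
  {set I} := [set i | x \in E i]%SET.

Lemma in_members (T : Type) (I : finType) (E : I -> set T) (x : T) i :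
  (i \in members E x) = (x \in E i).
Proof. by rewrite inE. Qed.

Lemma sum_members (T : Type) (R : realType) (I : finType) (E : I -> set T)
    (c : I -> R) (x : T) :
  \sum_(i in members E x) c i = \sum_i c i * \1_(E i) x.
Proof.
rewrite big_mkcond/=; apply: eq_bigr => i _.
by rewrite in_members indicE; case: (_ \in _); rewrite ?mulr1 ?mulr0.
Qed.

Section finite_families.
Local Open Scope ereal_scope.
Context d (X : measurableType d) (R : realType).
Variable mu : {measure set X -> \bar R}.
Context (I : finType) (E : I -> set X).
Hypothesis mE : forall i, measurable (E i).

(** [members E] takes finitely many values, and its fibres are finite intersections of the [E i] and
    their complements; hence [h] may be arbitrary. *)
Lemma measurable_fun_members d' (Y : measurableType d') (h : {set I} -> Y) :
  measurable_fun [set: X] (fun x => h (members E x)).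
Proof.
move=> _ B mB; rewrite setTI.
rewrite (_ : _ @^-1` B = \bigcup_(S in [set S | B (h S)])
   [set x | members E x = S]); last first.
  apply/seteqP; split => [x Bx|x [S BS /= xS]] /=; last by rewrite xS.
  by exists (members E x).
apply: fin_bigcup_measurable; first exact: finite_finset.
move=> S _.
rewrite (_ : [set x | _] = \bigcap_(i in [set: I])
    (if i \in S then E i else ~` E i)); last first.
  apply/seteqP; split => [x /= <- i _|x H] /=.
    by rewrite in_members; case: ifPn; rewrite ?inE// notin_setE.
  apply/setP => i; rewrite in_members; have := H i Logic.I.
  by case: ifPn => iS xi; [exact/mem_set|exact/memNset].
apply: fin_bigcap_measurable; first exact: finite_finset.
by move=> i _; case: ifPn => _ //; exact: measurableC.
Qed.

Lemma integral_mul_sum_members (w : I -> R) (g : X -> \bar R) :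
  (forall i, 0 <= w i)%R -> (forall x, 0 <= g x) -> measurable_fun [set: X] g ->
  \int[mu]_x (g x * (\sum_(i in members E x) w i)%:E) =
  \sum_i (w i)%:E * \int[mu]_(x in E i) g x.
Proof.
move=> w0 g0 mg.
transitivity (\int[mu]_x \sum_i (w i)%:E * (g \_ (E i)) x).
  apply: eq_integral => x _.
  rewrite -sumEFin ge0_sume_distrr; last by move=> i _; rewrite lee_fin.
  rewrite big_mkcond/=; apply: eq_bigr => i _.
  rewrite in_members patchE; case: ifPn => _; last by rewrite mule0.
  by rewrite muleC.
have gE i x : 0 <= (g \_ (E i)) x by rewrite patchE; case: ifP.
have mgE i : measurable_fun [set: X] (g \_ (E i)).
  by apply/(measurable_restrictT _ _).1 => //; exact: measurable_funTS.
rewrite ge0_integral_sum//; last 2 first.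
- by move=> i; exact: measurable_funeM.
- by move=> i x _; rewrite mule_ge0// lee_fin.
apply: eq_bigr => i _.
by rewrite ge0_integralZl_EFin// -integral_mkcond.
Qed.

Lemma integral_sum_members (w : I -> R) : (forall i, 0 <= w i)%R ->
  \int[mu]_x (\sum_(i in members E x) w i)%:E = \sum_i (w i)%:E * mu (E i).
Proof.
move=> w0; under eq_integral do rewrite -[X in X%:E]mul1r EFinM.
rewrite (@integral_mul_sum_members w (cst 1))//.
by apply: eq_bigr => i _; rewrite integral_cst// mul1e.
Qed.

Hypothesis Efin : forall i, mu (E i) < +oo.

(** The integrand is bounded and vanishes off the union of the [E i]. This supplies the finiteness
    that absorption requires. *)
Lemma integral_members_fin (h : {set I} -> R) :
  (forall S, 0 <= h S)%R -> h finset.set0 = 0%R ->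
  \int[mu]_x (h (members E x))%:E < +oo.
Proof.
move=> h0 h00; pose K := (\sum_S h S)%R.
have hK S : (h S <= K)%R.
  by rewrite /K (bigD1 S)//= lerDl sumr_ge0.
have K0 : (0 <= K)%R by exact: sumr_ge0.
apply: (@le_lt_trans _ _ (\int[mu]_x (\sum_(i in members E x) K)%:E)).
  apply: ge0_le_integral => //.
  - by move=> x _; rewrite lee_fin.
  - exact: (@measurable_fun_members _ _ (fun S => (h S)%:E)).
  - exact: (@measurable_fun_members _ _ (fun S => (\sum_(i in S) K)%:E)).
  - move=> x _; rewrite lee_fin.
    have [->|/set0Pn[i iS]] := eqVneq (members E x) finset.set0.
      by rewrite h00 big_set0.
    by apply: (le_trans (hK _)); rewrite (bigD1 i)//= lerDl sumr_ge0.
rewrite integral_sum_members//.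
apply: lte_sum_pinfty => i _.
by rewrite lte_mul_pinfty.
Qed.

End finite_families.

(** * Absorption of a finite integral *)

Section absorption.
Local Open Scope ereal_scope.
Context d (X : measurableType d) (R : realType).
Variable mu : {measure set X -> \bar R}.

(** Young's inequality splits [g * F ^ (p - 1)] so that half of the left-hand integral reappears on
    the right, where it can be subtracted because it is finite. *)
Lemma integral_powR_absorb (F : X -> R) (g : X -> \bar R) (p K : R) :
  (1 < p)%R -> (0 < K)%R -> (forall x, 0 <= F x)%R -> (forall x, 0 <= g x) ->
  measurable_fun [set: X] F -> measurable_fun setT g ->
  \int[mu]_x (F x `^ p)%:E < +oo ->
  \int[mu]_x (F x `^ p)%:E <= K%:E * \int[mu]_x (g x * (F x `^ (p - 1))%:E) ->
  \int[mu]_x (F x `^ p)%:E <= ((2 * K) `^ p)%:E * \int[mu]_x (g x `^ p).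
Proof.
move=> p1 K0 F0 g0 mF mg Ffin FK.
have p0 : (0 < p)%R by exact: lt_trans p1.
(* With this weight the term in [F ^ p] gets the coefficient [K / L = 1 / 2]. *)
pose L := (2 * K)%R.
have L0 : (0 < L)%R by rewrite mulr_gt0.
have mFp q : measurable_fun [set: X] (fun x => (F x `^ q)%:E).
  apply/measurable_EFinP.
  by apply: (@measurableT_comp _ _ _ _ _ _ (fun y : R => y `^ q)%R) => //; exact: measurable_powR.
have mgp : measurable_fun [set: X] (fun x => g x `^ p).
  by apply: (@measurableT_comp _ _ _ _ _ _ (fun y : \bar R => y `^ p)) => //; exact: measurable_poweR.
have young x : g x * (F x `^ (p - 1))%:E <=
    L^-1%:E * (F x `^ p)%:E + (L `^ (p - 1))%:E * g x `^ p.
  case: (g x) (g0 x) => [y y0|_|//]; last first.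
    rewrite eqy_poweR// gt0_muley ?lte_fin ?powR_gt0//.
    by rewrite addey ?leey// -EFinM.
  rewrite -EFinM poweR_EFin -!EFinM -EFinD lee_fin.
  rewrite lee_fin in y0.
  have [le|lt] := lerP y (L^-1 * F x).
    apply: (@le_trans _ _ (L^-1 * F x `^ p)%R); last first.
      by rewrite lerDl mulr_ge0 ?powR_ge0.
    rewrite -(@powR_mulDB1 _ _ p)// ?gt_eqF// mulrA ler_wpM2r// powR_ge0//.
  apply: (@le_trans _ _ (L `^ (p - 1) * y `^ p)%R); last first.
    by rewrite lerDr mulr_ge0 ?powR_ge0// invr_ge0 ltW.
  rewrite -(@powR_mulDB1 _ y p)// ?gt_eqF// mulrCA ler_wpM2l//.
  rewrite -powRM ?(ltW L0)// ge0_ler_powR ?nnegrE ?subr_ge0 ?(ltW p1)//.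
    by rewrite mulr_ge0// ltW.
  by rewrite -ler_pdivrMl// ltW.
set J := \int[mu]_x (F x `^ p)%:E in Ffin FK *.
have J0 : 0 <= J by apply: integral_ge0 => x _; rewrite lee_fin powR_ge0.
have {}FK : J <= K%:E * (L^-1%:E * J + (L `^ (p - 1))%:E * \int[mu]_x g x `^ p).
  apply: (le_trans FK); rewrite lee_pmul2l ?lte_fin//.
  have LV0 : (0 <= L^-1)%R by rewrite invr_ge0 ltW.
  rewrite -ge0_integralZl_EFin//; last by move=> x _; rewrite lee_fin powR_ge0.
  rewrite -ge0_integralZl_EFin ?powR_ge0//; last first.
    by move=> x _; rewrite poweR_ge0.
  rewrite -ge0_integralD//.
  - apply: ge0_le_integral => //.
    + by move=> x _; rewrite mule_ge0// lee_fin powR_ge0.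
    + exact: emeasurable_funM.
    + by apply: emeasurable_funD; exact: measurable_funeM.
  - by move=> x _; rewrite mule_ge0// lee_fin ?powR_ge0// invr_ge0 ltW.
  - exact: measurable_funeM.
  - by move=> x _; rewrite mule_ge0// ?poweR_ge0// lee_fin ?powR_ge0.
  - exact: measurable_funeM.
have : 0 <= \int[mu]_x g x `^ p.
  by apply: integral_ge0 => x _; exact: poweR_ge0.
have Jfin : J \is a fin_num by rewrite ge0_fin_numE.
case: (\int[mu]_x g x `^ p) FK => [m|_ _|//]; last first.
  by rewrite gt0_muley ?leey// lte_fin powR_gt0// mulr_gt0.
rewrite -(fineK Jfin) -!EFinM !lee_fin => H m0.
rewrite -(@powR_mulDB1 _ _ p) ?gt_eqF//; last by rewrite ltW.
have E : (K * (L^-1 * fine J) = 2^-1 * fine J)%R.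
  by rewrite mulrA /L; congr (_ * _)%R; field; rewrite gt_eqF.
rewrite mulrDr E in H; rewrite -/L.
have -> : (L * L `^ (p - 1) * m = 2 * (K * (L `^ (p - 1) * m)))%R.
  by rewrite {1}/L; ring.
lra.
Qed.

End absorption.

(** * Maximal inequalities for finite laminar families *)

(** Higher levels belong to smaller sets, and the sets through a point form a chain with distinct
    levels. Both conditions start from a common point, so empty sets may be repeated freely and
    serve as padding. *)
Definition laminar (T I : Type) (Q : I -> set T) (lev : I -> int) : Prop :=
  (forall i j x, Q i x -> Q j x -> lev i <= lev j -> Q j `<=` Q i) /\
  (forall i j x, Q i x -> Q j x -> lev i = lev j -> i = j).

Section laminar_combinatorics.
Context (T : Type) (I : finType) (Q : I -> set T) (lev : I -> int).
Hypothesis Qlev : laminar Q lev.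

Lemma laminar_lev_inj x : {in members Q x &, injective lev}.
Proof.
move=> i j; rewrite !in_members !inE => Qix Qjx.
exact: (Qlev.2 i j x).
Qed.

Definition above (op : rel int) (i : I) : {set I} :=
  [set j | op (lev j) (lev i) && `[< Q i `<=` Q j >]]%SET.

(** Sets through a point of [Q i] of level at most [lev i] contain [Q i], so the segment does not
    depend on the point. Expressions in these segments thus become constants attached to [i]. *)
Lemma members_above (op : rel int) (x : T) (i : I) :
  (forall a b, op a b -> a <= b) -> i \in members Q x ->
  [set j in members Q x | op (lev j) (lev i)]%SET = above op i.
Proof.
move=> opW; rewrite in_members inE => Qix.
apply/setP => j; rewrite !inE andbC; have [op_ji/=|//] := boolP (op _ _).
apply/idP/asboolP; first by rewrite inE => Qjx; exact: (Qlev.1 j i x Qjx Qix (opW _ _ op_ji)).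
by move=> /(_ _ Qix) Qjx; rewrite inE.
Qed.

Lemma sum_above (R : realType) (c : I -> R) (x : T) (i : I) :
  i \in members Q x ->
  \sum_(j in members Q x | lev j <= lev i) c j = \sum_(j in above <=%R i) c j.
Proof.
by move=> xi; rewrite -(@members_above _ x)//; apply: eq_bigl => j; rewrite inE.
Qed.

End laminar_combinatorics.

Lemma max_over_ge (R : realType) (I : finType) (a : I -> R) (b0 : R)
  (B : {set I}) : b0 <= max_over a b0 B.
Proof. exact: bigmax_ge_id. Qed.

Lemma le_max_over (R : realType) (I : finType) (a : I -> R) (b0 : R)
  (B : {set I}) i : i \in B -> a i <= max_over a b0 B.
Proof. by move=> iB; apply: (@le_bigmax_cond _ _ _ b0 i (mem B)). Qed.

Lemma max_over_set0 (R : realType) (I : finType) (a : I -> R) (b0 : R) :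
  max_over a b0 finset.set0 = b0.
Proof. by rewrite /max_over big_set0. Qed.

Lemma max_over_subset (R : realType) (I : finType) (a : I -> R) (b0 : R)
  (A B : {set I}) : A \subset B -> max_over a b0 A <= max_over a b0 B.
Proof.
move=> AB; apply: bigmax_le => [|i iA]; first exact: max_over_ge.
exact/le_max_over/(fintype.subsetP AB).
Qed.

Section laminar_integrals.
Local Open Scope ereal_scope.
Context d (X : measurableType d) (R : realType).
Variable mu : {measure set X -> \bar R}.
Context (I : finType) (Q : I -> set X) (lev : I -> int).
Hypothesis Qlev : laminar Q lev.
Hypothesis mQ : forall i, measurable (Q i).

(** This is [chain_max_le] integrated: the increments of [Psi] are constants [w i] on [Q i], so
    [a i] may be exchanged for the average of [g] there, after which they telescope back to
    [Psi]. *)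
Lemma integral_max_over_le (a : I -> R) (b0 : R) (Phi Psi : R -> R)
    (g : X -> \bar R) :
  (0 <= b0)%R -> (forall i, 0 <= a i)%R ->
  (forall x, 0 <= g x) -> measurable_fun [set: X] g ->
  (forall i, (a i)%:E * mu (Q i) <= \int[mu]_(x in Q i) g x) ->
  {in `[b0, +oo[ &, {homo Phi : x y / (x <= y)%R}} ->
  {in `[b0, +oo[ &, {homo Psi : x y / (x <= y)%R}} ->
  (forall x y, b0 <= y <= x -> Phi x - Phi y <= x * (Psi x - Psi y))%R ->
  \int[mu]_x (Phi (max_over a b0 (members Q x)) - Phi b0)%:E <=
  \int[mu]_x (g x * (Psi (max_over a b0 (members Q x)) - Psi b0)%:E).
Proof.
move=> b00 a0 g0 mg ag homoPhi homoPsi PhiPsi.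
have b0in S : max_over a b0 S \in `[b0, +oo[.
  by rewrite in_itv/= max_over_ge.
have b0b : b0 \in `[b0, +oo[ by rewrite in_itv/= lexx.
pose w i := (Psi (max_over a b0 (above Q lev <=%R i))
             - Psi (max_over a b0 (above Q lev <%R i)))%R.
have w0 i : (0 <= w i)%R.
  rewrite subr_ge0 homoPsi//; apply: max_over_subset.
  apply/fintype.subsetP => j; rewrite !inE => /andP[/ltW -> ->//].
have wE x i : i \in members Q x ->
   w i = (Psi (max_over a b0 [set j in members Q x | (lev j <= lev i)%R]%SET)
     - Psi (max_over a b0 [set j in members Q x | (lev j < lev i)%R]%SET))%R.
  move=> xi; rewrite (members_above Qlev _ xi)//.
  by rewrite (members_above Qlev _ xi)// => ? ? /ltW.
have sumw x : (\sum_(i in members Q x) w i =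
    Psi (max_over a b0 (members Q x)) - Psi b0)%R.
  have := chain_telescope (fun S => Psi (max_over a b0 S))
    (laminar_lev_inj Qlev (x := x)).
  by rewrite max_over_set0 => <-; apply: eq_bigr => i /wE.
under [leRHS]eq_integral do rewrite -sumw.
rewrite integral_mul_sum_members//.
apply: (@le_trans _ _ (\sum_i (w i * a i)%:E * mu (Q i))); last first.
  apply: lee_sum => i _.
  by rewrite EFinM -muleA lee_wpmul2l ?lee_fin.
rewrite -integral_sum_members//; last by move=> i; rewrite mulr_ge0.
apply: ge0_le_integral => //.
- by move=> x _; rewrite lee_fin subr_ge0 homoPhi// max_over_ge.
- exact: (@measurable_fun_members _ _ _ _ mQ _ _
    (fun S => (Phi (max_over a b0 S) - Phi b0)%:E)).
- exact: (@measurable_fun_members _ _ _ _ mQ _ _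
    (fun S => (\sum_(i in S) w i * a i)%:E)).
- move=> x _; rewrite lee_fin.
  apply: (le_trans (chain_max_le (laminar_lev_inj Qlev (x := x)) a PhiPsi)).
  by apply: ler_sum => i xi; rewrite (wE x i xi) mulrC.
Qed.

End laminar_integrals.

Definition doob_const (R : realType) (p : R) : R :=
  (2 * ((1 + p) * (1 + (p - 1)^-1))) `^ p.

Lemma doob_const_gt0 (R : realType) (p : R) : 1 < p -> 0 < doob_const p.
Proof.
move=> p1; have pV : 0 < (p - 1)^-1 by rewrite invr_gt0 subr_gt0.
by rewrite powR_gt0// !mulr_gt0//; lra.
Qed.

Section maximal_inequalities.
Local Open Scope ereal_scope.
Context d (X : measurableType d) (R : realType).
Variable mu : {measure set X -> \bar R}.
Context (I : finType) (Q : I -> set X) (lev : I -> int).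
Hypothesis Qlev : laminar Q lev.
Hypothesis mQ : forall i, measurable (Q i).
Hypothesis Qfin : forall i, mu (Q i) < +oo.

Lemma doob_maximal (a : I -> R) (g : X -> \bar R) (p : R) :
  (1 < p)%R -> (forall i, 0 <= a i)%R ->
  (forall x, 0 <= g x) -> measurable_fun [set: X] g ->
  (forall i, (a i)%:E * mu (Q i) <= \int[mu]_(x in Q i) g x) ->
  \int[mu]_x (max_over a 0 (members Q x) `^ p)%:E <=
  (doob_const p)%:E * \int[mu]_x (g x `^ p).
Proof.
move=> p1 a0 g0 mg ag.
have p0 : (0 < p)%R by exact: lt_trans p1.
set K := ((1 + p) * (1 + (p - 1)^-1))%R.
have K0 : (0 < K)%R.
  have : (0 < (p - 1)^-1)%R by rewrite invr_gt0 subr_gt0.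
  by move=> ?; rewrite mulr_gt0//; lra.
have M0 S : (0 <= max_over a 0 S)%R by exact: max_over_ge.
apply: integral_powR_absorb => //.
- exact: (@measurable_fun_members _ _ _ _ mQ _ _ (max_over a 0)).
- apply: (@integral_members_fin _ _ _ mu _ _ mQ Qfin
    (fun S => max_over a 0 S `^ p)%R).
    by move=> S; rewrite powR_ge0.
  by rewrite max_over_set0 powR0// gt_eqF.
have maxle := @integral_max_over_le _ _ _ mu _ _ _ Qlev mQ a 0
  (fun y => y `^ p)%R (fun y => K * y `^ (p - 1))%R g (lexx _) a0 g0 mg ag.
have homo q : (0 <= q)%R -> {in `[0%R, +oo[ &, {homo (@powR R)^~ q : x y / (x <= y)%R}}.
  by move=> q0 x y; rewrite !in_itv/= !andbT => x0 y0; exact: ge0_ler_powR.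
have q0 : (0 < p - 1)%R by rewrite subr_gt0.
have {maxle} := maxle (homo _ (ltW p0)).
rewrite !powR0 ?gt_eqF// mulr0.
under eq_integral do rewrite subr0.
move=> maxle; apply: (le_trans (maxle _ _)).
- by move=> x y x0 y0 xy; rewrite ler_pM2l// homo// ltW.
- move=> x y xy; apply: (le_trans (powR_increment_doob p1 xy)).
  by rewrite -/K mulrCA mulrBr.
under eq_integral do rewrite subr0 EFinM muleCA.
rewrite ge0_integralZl_EFin//.
- by move=> x _; rewrite mule_ge0// lee_fin powR_ge0.
- apply: emeasurable_funM => //.
  exact: (@measurable_fun_members _ _ _ _ mQ _ _
    (fun S => (max_over a 0 S `^ (p - 1))%:E)).
- exact: ltW.
Qed.

(* Below the exponent 1, [b] only has to dominate the average of [g]. *)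
Lemma kolmogorov_maximal (a : I -> R) (g : X -> \bar R) (b k : R) (D : set X) :
  (0 < k < 1)%R -> (0 < b)%R -> measurable D -> (forall i, 0 <= a i)%R ->
  (forall i, Q i `<=` D) ->
  (forall x, 0 <= g x) -> measurable_fun [set: X] g ->
  (forall i, (a i)%:E * mu (Q i) <= \int[mu]_(x in Q i) g x) ->
  \int[mu]_(x in D) g x <= b%:E * mu D ->
  \int[mu]_(x in D) (max_over a b (members Q x) `^ k)%:E <=
  ((1 + (1 + k) * (1 + (1 - k)^-1)) * b `^ k)%:E * mu D.
Proof.
move=> k01 b0 mD a0 QD g0 mg ag gD; have /andP[k0 k1] := k01.
set K := ((1 + k) * (1 + (1 - k)^-1))%R.
have K0 : (0 < K)%R.
  have : (0 < (1 - k)^-1)%R by rewrite invr_gt0 subr_gt0.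
  by move=> ?; rewrite mulr_gt0//; lra.
have Mb S : (b <= max_over a b S)%R by exact: max_over_ge.
have homo : {in `[b, +oo[ &, {homo (fun y => y `^ k)%R : x y / (x <= y)%R}}.
  move=> x y; rewrite !in_itv/= !andbT => x0 y0; apply: ge0_ler_powR.
  - exact: ltW.
  - by rewrite nnegrE; lra.
  - by rewrite nnegrE; lra.
have anti (y z : R) : (b <= y)%R -> (y <= z)%R -> (z `^ (k - 1) <= y `^ (k - 1))%R.
  by move=> yb yz; apply: powR_antitone => //; lra.
have antiPsi : {in `[b, +oo[ &,
    {homo (fun y => - (K * y `^ (k - 1)))%R : x y / (x <= y)%R}}.
  move=> x y; rewrite !in_itv/= !andbT => x0 y0 xy.
  by rewrite lerN2 ler_pM2l// anti.
have PhiPsi (x y : R) : (b <= y <= x)%R -> (x `^ k - y `^ k <=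
    x * (- (K * x `^ (k - 1)) - - (K * y `^ (k - 1))))%R.
  move=> /andP[by' yx].
  have := @powR_increment_kolmogorov R x y k k01.
  rewrite (lt_le_trans b0 by') yx => /(_ isT) /le_trans; apply.
  by rewrite -/K le_eqVlt; apply/orP; left; apply/eqP; ring.
have H := integral_max_over_le Qlev mQ (ltW b0) a0 g0 mg ag homo antiPsi PhiPsi.
set h := fun S => (max_over a b S `^ k - b `^ k)%R.
have h0 S : (0 <= h S)%R by rewrite subr_ge0 homo// in_itv/= ?lexx ?Mb.
have mh : measurable_fun [set: X] (fun x => (h (members Q x))%:E).
  exact: (@measurable_fun_members _ _ _ _ mQ _ _ (fun S => (h S)%:E)).
(* [Psi] is negative, so its increment from [b] is at most [K * b ^ (k - 1)]. Outside [D] no set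
   occurs, the maximum is [b] and the increment is zero. *)
have hD : \int[mu]_(x in D) (h (members Q x))%:E <=
    (K * b `^ (k - 1))%:E * \int[mu]_(x in D) g x.
  apply: (@le_trans _ _ (\int[mu]_x (h (members Q x))%:E)).
    by apply: ge0_subset_integral => // x _; rewrite lee_fin.
  apply: (le_trans H).
  rewrite -ge0_integralZl_EFin//; last 2 first.
  - exact: measurable_funTS.
  - by rewrite mulr_ge0 ?powR_ge0// ltW.
  rewrite [leRHS]integral_mkcond.
  apply: ge0_le_integral => //.
  - move=> x _; rewrite mule_ge0// lee_fin opprK addrC -mulrBr.
    by rewrite mulr_ge0 ?(ltW K0)// subr_ge0 anti.
  - apply: emeasurable_funM => //.
    exact: (@measurable_fun_members _ _ _ _ mQ _ _
      (fun S => (- (K * max_over a b S `^ (k - 1)) - - (K * b `^ (k - 1)))%:E)).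
  - apply/(measurable_restrictT _ mD).1.
    by apply: measurable_funeM; exact: measurable_funTS.
  - move=> x _; rewrite patchE; case: ifPn => xD.
      rewrite muleC lee_wpmul2r// lee_fin opprK gerDr oppr_le0.
      by rewrite mulr_ge0 ?powR_ge0// ltW.
    rewrite (_ : members Q x = finset.set0) ?max_over_set0 ?subrr ?mule0//.
    apply/setP => i; rewrite in_members inE; apply/negbTE.
    by apply: contra xD; rewrite !inE => /QD.
have bk0 : (0 <= b `^ k)%R by exact: powR_ge0.
apply: (@le_trans _ _ (\int[mu]_(x in D) ((b `^ k)%:E + (h (members Q x))%:E))).
  apply: ge0_le_integral => //.
  - by move=> x _; rewrite lee_fin powR_ge0.
  - apply: measurable_funTS.
    exact: (@measurable_fun_members _ _ _ _ mQ _ _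
      (fun S => (max_over a b S `^ k)%:E)).
  - by apply: emeasurable_funD => //; exact: measurable_funTS.
  - by move=> x _; rewrite -EFinD lee_fin /h subrKC.
rewrite ge0_integralD//; last 2 first.
- by move=> x _; rewrite lee_fin.
- exact: measurable_funTS.
rewrite integral_cst// mulrDl mul1r EFinD ge0_muleDl ?lee_fin//; last first.
  by rewrite mulr_ge0// ltW.
apply: leeD => //; apply: (le_trans hD).
apply: (@le_trans _ _ ((K * b `^ (k - 1))%:E * (b%:E * mu D))).
  by rewrite lee_wpmul2l// lee_fin mulr_ge0 ?powR_ge0// ltW.
rewrite muleA -EFinM -mulrA (mulrC _ b) powR_mulDB1 ?gt_eqF//.
exact: ltW.
Qed.

End maximal_inequalities.

(** * Large subsets *)

(** The first term is the absorption constant for [p > 1], the second that of a pointwise comparison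
    for [p <= 1]. *)
Definition large_const (R : realType) (p : R) : R :=
  (2 * (2 * (1 + p))) `^ p + 2 * (1 + p) * (1 + p^-1).

Lemma large_const_gt0 (R : realType) (p : R) : 0 < p -> 0 < large_const p.
Proof.
move=> p0; have pV : 0 < p^-1 by rewrite invr_gt0.
by rewrite addr_gt0// ?powR_gt0 ?mulr_gt0//; lra.
Qed.

Section large_subsets.
Local Open Scope ereal_scope.
Context d (X : measurableType d) (R : realType).
Variable mu : {measure set X -> \bar R}.
Context (I : finType) (Q : I -> set X) (lev : I -> int).
Hypothesis Qlev : laminar Q lev.
Hypothesis mQ : forall i, measurable (Q i).
Hypothesis Qfin : forall i, mu (Q i) < +oo.

(* The partial sums [u i] from the top are constant on [Q i], so that in the
   integral of [\sum_i c i * u i `^ (p - 1) * \1_(Q i)] each [Q i] can be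
   replaced by [E i]. *)
Lemma integral_sum_large_subsets (E : I -> set X) (c : I -> R) (p : R) :
  (0 < p)%R -> (forall i, 0 <= c i)%R ->
  (forall i, measurable (E i)) -> (forall i, E i `<=` Q i) ->
  (forall i, mu (Q i) <= 2%:E * mu (E i)) ->
  \int[mu]_x ((\sum_(i in members Q x) c i) `^ p)%:E <=
  (large_const p)%:E * \int[mu]_x ((\sum_(i in members E x) c i) `^ p)%:E.
Proof.
move=> p0 c0 mE EQ QE.
pose u i := (\sum_(j in above Q lev <=%R i) c j)%R.
have cs0 (S : {set I}) : (0 <= \sum_(i in S) c i)%R by exact: sumr_ge0.
have cle (S : {set I}) i : i \in S -> (c i <= \sum_(j in S) c j)%R.
  by move=> iS; rewrite (bigD1 i)//= lerDl sumr_ge0.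
have css (A B : {set I}) : A \subset B ->
    (\sum_(j in A) c j <= \sum_(j in B) c j)%R.
  move=> /fintype.subsetP AB; rewrite big_mkcond [leRHS]big_mkcond/=.
  apply: ler_sum => i _.
  by case: ifPn => [/AB ->//|_]; case: ifP.
have EQm x : members E x \subset members Q x.
  apply/fintype.subsetP => i; rewrite !in_members !inE; exact: EQ.
have cu0 i : (0 <= c i * u i `^ (p - 1))%R by rewrite mulr_ge0 ?powR_ge0.
have step : \int[mu]_x ((\sum_(i in members Q x) c i) `^ p)%:E <=
    (2 * (1 + p))%:E *
    \int[mu]_x (\sum_(i in members E x) c i * u i `^ (p - 1))%:E.
  apply: (@le_trans _ _ (\int[mu]_x
     (\sum_(i in members Q x) (1 + p) * (c i * u i `^ (p - 1)))%:E)).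
    apply: ge0_le_integral => //.
    - by move=> x _; rewrite lee_fin powR_ge0.
    - exact: (@measurable_fun_members _ _ _ _ mQ _ _
        (fun S => ((\sum_(i in S) c i) `^ p)%:E)).
    - exact: (@measurable_fun_members _ _ _ _ mQ _ _
        (fun S => (\sum_(i in S) (1 + p) * (c i * u i `^ (p - 1)))%:E)).
    - move=> x _; rewrite lee_fin -mulr_sumr.
      apply: (le_trans (chain_powR_le (laminar_lev_inj Qlev (x := x)) p0 c0)).
      rewrite ler_wpM2l//; first by lra.
      by apply: ler_sum => i xi; rewrite (sum_above Qlev).
  rewrite !integral_sum_members//; last first.
    by move=> i; rewrite mulr_ge0//; lra.
  rewrite ge0_sume_distrr; last first.
    by move=> i _; rewrite mule_ge0// lee_fin.
  apply: lee_sum => i _.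
  rewrite (mulrC 2%R) (EFinM (1 + p) (c i * _)) (EFinM (1 + p) 2) -!muleA.
  rewrite lee_wpmul2l ?lee_fin//; first by lra.
  by rewrite [leRHS]muleCA lee_wpmul2l// lee_fin.
have K0 : (0 < 2 * (1 + p))%R by lra.
have mF : measurable_fun [set: X]
    (fun x => (\sum_(i in members Q x) c i)%R).
  exact: (@measurable_fun_members _ _ _ _ mQ _ _
    (fun S => (\sum_(i in S) c i)%R)).
have mphi : measurable_fun [set: X]
    (fun x => (\sum_(i in members E x) c i)%:E).
  exact: (@measurable_fun_members _ _ _ _ mE _ _
    (fun S => (\sum_(i in S) c i)%:E)).
have mcu : measurable_fun [set: X]
    (fun x => (\sum_(i in members E x) c i * u i `^ (p - 1))%:E).
  exact: (@measurable_fun_members _ _ _ _ mE _ _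
    (fun S => (\sum_(i in S) c i * u i `^ (p - 1))%:E)).
have mphip : measurable_fun [set: X]
    (fun x => ((\sum_(i in members E x) c i) `^ p)%:E).
  exact: (@measurable_fun_members _ _ _ _ mE _ _
    (fun S => ((\sum_(i in S) c i) `^ p)%:E)).
have J0 : 0 <= \int[mu]_x ((\sum_(i in members E x) c i) `^ p)%:E.
  by apply: integral_ge0 => x _; rewrite lee_fin powR_ge0.
have h1 : (0 <= (2 * (2 * (1 + p))) `^ p)%R by exact: powR_ge0.
have pV : (0 < p^-1)%R by rewrite invr_gt0.
have h2 : (0 <= 2 * (1 + p) * (1 + p^-1))%R.
  by rewrite !mulr_ge0//; lra.
(* For [p <= 1] the power [p - 1] does not increase: restricting [u i] to the sets [E j] through the
   point can only enlarge the term, and [chain_powR_ge] sums the result. *)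
have [p1|p1] := ltrP 1 p; last first.
  apply: (@le_trans _ _ ((2 * (1 + p) * (1 + p^-1))%:E *
    \int[mu]_x ((\sum_(i in members E x) c i) `^ p)%:E)); last first.
    by rewrite lee_wpmul2r// lee_fin /large_const lerDr.
  apply: (le_trans step); rewrite (EFinM _ (1 + p^-1)) -muleA.
  rewrite lee_wpmul2l ?lee_fin ?(ltW K0)//.
  rewrite -ge0_integralZl_EFin//; last 2 first.
  - by move=> x _; rewrite lee_fin powR_ge0.
  - by lra.
  apply: ge0_le_integral => //.
  - by move=> x _; rewrite lee_fin sumr_ge0.
  - exact: measurable_funeM.
  - move=> x _; rewrite -EFinM lee_fin.
    have injE : {in members E x &, injective lev}.
      by move=> i j /(fintype.subsetP (EQm x)) iQ /(fintype.subsetP (EQm x)) jQ;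
        exact: (laminar_lev_inj Qlev iQ jQ).
    apply: le_trans (chain_powR_ge injE p0 c0).
    apply: ler_sum => i xi.
    have xQ := fintype.subsetP (EQm x) i xi.
    have [->|ci] := eqVneq (c i) 0%R; first by rewrite !mul0r.
    rewrite ler_wpM2l// powR_antitone ?subr_le0//.
      rewrite (bigD1 i)/= ?xi ?lexx//.
      by rewrite ltr_pwDl ?sumr_ge0// lt_neqAle eq_sym ci c0.
    rewrite /u -(sum_above Qlev _ xQ) big_mkcond [leRHS]big_mkcond/=.
    apply: ler_sum => j _; case: ifPn => [/andP[/(fintype.subsetP (EQm x)) -> ->//]|_].
    by case: ifP.
(* For [p > 1] each [u i] is at most the full sum over the [Q j] through the point, and absorption
   applies. *)
apply: (@le_trans _ _ (((2 * (2 * (1 + p))) `^ p)%:E *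
    \int[mu]_x ((\sum_(i in members E x) c i) `^ p)%:E)); last first.
  by rewrite lee_wpmul2r// lee_fin /large_const lerDl.
apply: (integral_powR_absorb (F := fun x => (\sum_(i in members Q x) c i)%R)
   (g := fun x => (\sum_(i in members E x) c i)%:E)) => //.
- by move=> x; rewrite lee_fin.
- apply: (@integral_members_fin _ _ _ mu _ _ mQ Qfin
    (fun S => (\sum_(i in S) c i) `^ p)%R).
    by move=> S; rewrite powR_ge0.
  by rewrite big_set0 powR0// gt_eqF.
apply: (le_trans step); rewrite lee_wpmul2l ?lee_fin ?(ltW K0)//.
apply: ge0_le_integral => //.
- by move=> x _; rewrite lee_fin sumr_ge0.
- apply: emeasurable_funM => //.
  exact: (@measurable_fun_members _ _ _ _ mQ _ _
    (fun S => ((\sum_(i in S) c i) `^ (p - 1))%:E)).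
- move=> x _; rewrite -EFinM lee_fin mulr_suml.
  apply: ler_sum => i xi; rewrite ler_wpM2l//.
  have xQ := fintype.subsetP (EQm x) i xi.
  rewrite ge0_ler_powR ?nnegrE ?subr_ge0 ?(ltW p1)//; first exact: sumr_ge0.
  rewrite /u -(sum_above Qlev _ xQ) big_mkcond [leRHS]big_mkcond/=.
  apply: ler_sum => j _; case: ifPn => [/andP[-> _]//|_].
  by case: ifP.
Qed.

End large_subsets.

(** * Countable sums *)

Definition wsum (T : Type) (R : realType) (c : nat -> R) (E : nat -> set T)
  (x : T) : \bar R := (\sum_(i <oo) (c i * \1_(E i) x)%:E)%E.

Definition initial (T : Type) (E : nat -> T) (N : nat) : 'I_N -> T :=
  fun i => E i.

Section weighted_sums.
Local Open Scope ereal_scope.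
Context d (X : measurableType d) (R : realType).
Variable mu : {measure set X -> \bar R}.
Context (E : nat -> set X).
Hypothesis mE : forall i, measurable (E i).
Implicit Types c : nat -> R.

Lemma wsum_term_ge0 c x i : (forall i, 0 <= c i)%R ->
  0 <= (c i * \1_(E i) x)%:E.
Proof. by move=> c0; rewrite lee_fin mulr_ge0. Qed.

Lemma wsum_ge0 c x : (forall i, 0 <= c i)%R -> 0 <= wsum c E x.
Proof. by move=> c0; apply: nneseries_ge0 => i _ _; exact: wsum_term_ge0. Qed.

Lemma initial_sum c N x :
  \sum_(0 <= i < N) (c i * \1_(E i) x)%:E =
  (\sum_(i in members (initial E (N:=N)) x) c i)%:E.
Proof. by rewrite sum_members sumEFin big_mkord. Qed.

Lemma initial_sum_le_wsum c N x : (forall i, 0 <= c i)%R ->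
  (\sum_(i in members (initial E (N:=N)) x) c i)%:E <= wsum c E x.
Proof.
move=> c0; rewrite -initial_sum; apply: nneseries_lim_ge => i *.
exact: wsum_term_ge0.
Qed.

Lemma measurable_wsum c : (forall i, 0 <= c i)%R ->
  measurable_fun [set: X] (wsum c E).
Proof.
move=> c0; apply: ge0_emeasurable_sum => [i x _ _|i _].
  exact: wsum_term_ge0.
by apply/measurable_EFinP; exact: measurable_funM.
Qed.

Lemma measurable_wsum_poweR c p : (forall i, 0 <= c i)%R ->
  measurable_fun [set: X] (fun x => wsum c E x `^ p).
Proof.
move=> c0.
apply: (@measurableT_comp _ _ _ _ _ _ (fun y : \bar R => y `^ p)).
  exact: measurable_poweR.
exact: measurable_wsum.
Qed.

Lemma le_wsum c c' x : (forall i, 0 <= c i)%R -> (forall i, c i <= c' i)%R ->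
  wsum c E x <= wsum c' E x.
Proof.
move=> c0 cc'; apply: lee_nneseries => [i _ _|i _]; first exact: wsum_term_ge0.
by rewrite lee_fin ler_wpM2r ?cc'//.
Qed.

Lemma measurable_initial_sum c N p :
  measurable_fun [set: X] (fun x =>
    ((\sum_(i in members (initial E (N:=N)) x) c i) `^ p)%:E).
Proof.
exact: (@measurable_fun_members _ _ _ _ (fun i : 'I_N => mE i) _ _
  (fun S => ((\sum_(i in S) c i) `^ p)%:E)).
Qed.

(** Monotone convergence along the initial sums; it reduces each of the bounds below to finite
    families. *)
Lemma integral_wsum_poweR_le (D : set X) c p (B : \bar R) :
  measurable D -> (0 < p)%R -> (forall i, 0 <= c i)%R ->
  (forall N, \int[mu]_(x in D)
    ((\sum_(i in members (initial E (N:=N)) x) c i) `^ p)%:E <= B) ->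
  \int[mu]_(x in D) (wsum c E x `^ p) <= B.
Proof.
move=> mD p0 c0 NB.
pose u N x := (\sum_(i in members (initial E (N:=N)) x) c i)%R.
have u0 N x : (0 <= u N x)%R by exact: sumr_ge0.
have und x : {homo u^~ x : m n / (m <= n)%N >-> (m <= n)%R}.
  move=> m n mn; rewrite -lee_fin -!initial_sum.
  by apply: lee_sum_nneg_natr => // i _ _; exact: wsum_term_ge0.
pose v N x := (u N x `^ p)%:E.
have vnd x : {homo v^~ x : m n / (m <= n)%N >-> m <= n}.
  move=> m n mn; rewrite lee_fin ge0_ler_powR ?nnegrE//; first exact: ltW.
  exact: und.
have mv N : measurable_fun D (v N).
  by apply: measurable_funTS; exact: measurable_initial_sum.
(* The power passes to the limit by comparing the partial sums with the [1 / p]-th power of the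
   limit; only monotonicity of powers enters. *)
have le x : D x -> wsum c E x `^ p <= limn (v^~ x).
  move=> Dx.
  have vlim N : v N x <= limn (v^~ x).
    apply: lime_ge; first exact: ereal_nondecreasing_is_cvgn.
    by near=> n; apply: vnd; near: n; exact: nbhs_infty_ge.
  have l0 : 0 <= limn (v^~ x).
    by apply: (le_trans _ (vlim 0%N)); rewrite lee_fin powR_ge0.
  have : wsum c E x <= limn (v^~ x) `^ p^-1.
    rewrite /wsum; apply: lime_le.
      by apply: is_cvg_nneseries => i _ _; exact: wsum_term_ge0.
    near=> N; rewrite /eseries/= initial_sum.
    have -> : (\sum_(i in members (initial E (N:=N)) x) c i)%:E =
        v N x `^ p^-1.
      by rewrite /v poweR_EFin -powRrM mulfV ?gt_eqF// powRr1 ?u0//.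
    apply: gt0_ler_poweR; rewrite ?invr_ge0 ?(ltW p0)//.
    - by rewrite in_itv/= leey lee_fin powR_ge0.
    - by rewrite in_itv/= leey l0.
  move=> H.
  have := @gt0_ler_poweR R p (ltW p0) (wsum c E x) (limn (v^~ x) `^ p^-1).
  rewrite !in_itv/= !leey !andbT wsum_ge0// poweR_ge0 => /(_ isT isT H).
  by rewrite -poweRrM mulVf ?gt_eqF// poweRe1.
apply: (@le_trans _ _ (\int[mu]_(x in D) limn (v^~ x))).
  apply: ge0_le_integral => //.
  - by move=> x _; exact: poweR_ge0.
  - by apply: measurable_funTS; exact: measurable_wsum_poweR.
  - apply: emeasurable_fun_cvg mv _ => x _.
    exact: ereal_nondecreasing_is_cvgn.
rewrite monotone_convergence//; last first.
  by move=> N x _; rewrite lee_fin powR_ge0.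
apply: lime_le; last by apply: nearW => N; exact: NB.
apply: ereal_nondecreasing_is_cvgn => m n mn; apply: ge0_le_integral => //.
- by move=> x _; rewrite lee_fin powR_ge0.
- by move=> x _; exact: vnd.
Unshelve. all: by end_near. Qed.

Lemma integral_initial_sum_le c N p :
  (0 < p)%R -> (forall i, 0 <= c i)%R ->
  \int[mu]_x ((\sum_(i in members (initial E (N:=N)) x) c i) `^ p)%:E <=
  \int[mu]_x (wsum c E x `^ p).
Proof.
move=> p0 c0; apply: ge0_le_integral => //.
- by move=> x _; rewrite lee_fin powR_ge0.
- exact: measurable_initial_sum.
- exact: measurable_wsum_poweR.
- move=> x _; rewrite -poweR_EFin; apply: gt0_ler_poweR; first exact: ltW.
  + by rewrite in_itv/= leey andbT lee_fin sumr_ge0.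
  + by rewrite in_itv/= leey andbT wsum_ge0.
  + exact: initial_sum_le_wsum.
Qed.

End weighted_sums.

Lemma laminar_initial (T : Type) (Q : nat -> set T) (lev : nat -> int) N :
  laminar Q lev -> laminar (initial Q (N:=N)) (initial lev (N:=N)).
Proof.
move=> [Q1 Q2]; split => [i j x|i j x Qi Qj ij]; first exact: Q1.
by apply: val_inj; exact: (Q2 _ _ x).
Qed.

(** * Countable laminar families *)

(** Stands for the local sum: for the enumerated cubes, a set through a point of [Q i] has level at
    least [lev i] exactly when it lies in [Q i]. Selecting by level gives a weighted sum defined on
    the whole space. *)
Definition tail_coef (R : realType) (lev : nat -> int) (lam : nat -> R)
  (i j : nat) : R := if lev i <= lev j then lam j else 0.

Definition upper_const (R : realType) (q r : R) : R := 1 + doob_const (r / q).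

Definition kolmogorov_const (R : realType) (k : R) : R :=
  1 + (1 + k) * (1 + (1 - k)^-1).

Lemma kolmogorov_const_gt0 (R : realType) (k : R) :
  0 < k < 1 -> 0 < kolmogorov_const k.
Proof.
move=> /andP[k0 k1]; have kV : 0 < (1 - k)^-1 by rewrite invr_gt0 subr_gt0.
by rewrite /kolmogorov_const addr_gt0// mulr_gt0//; lra.
Qed.

(** Twice the coefficient of [powR_young_eps] at [e = (2 * K)^-1], with [K] Kolmogorov's constant;
    the factor 2 comes from absorbing half of the average. *)
Definition average_const (R : realType) (theta rho : R) : R :=
  let k := (1 - rho) / (1 - theta) in
  2 * ((2 * kolmogorov_const k)^-1) `^ (- ((1 - theta) / theta)).

Section countable_laminar.
Local Open Scope ereal_scope.
Context d (X : measurableType d) (R : realType).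
Variable mu : {measure set X -> \bar R}.
Context (Q : nat -> set X) (lev : nat -> int) (lam al : nat -> R) (q : R).
Hypothesis Qlev : laminar Q lev.
Hypothesis mQ : forall i, measurable (Q i).
Hypothesis Qfin : forall i, mu (Q i) < +oo.
Hypothesis lam0 : forall i, (0 <= lam i)%R.
Hypothesis al0 : forall i, (0 < al i)%R.
Hypothesis q0 : (0 < q)%R.

Let tl i := wsum (tail_coef lev lam i) Q.
Let f := wsum lam Q.

(** [al i] is the average of the [q]-th power before the root is taken, hence the factor [q^-1] in
    its exponents below. The product form also covers empty sets. *)
Hypothesis al_average : forall i,
  (al i)%:E * mu (Q i) = \int[mu]_(x in Q i) (tl i x `^ q).

Let QN N := initial Q (N:=N).
Let mQN N (i : 'I_N) : measurable (QN i). Proof. exact: mQ. Qed.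
Let QfinN N (i : 'I_N) : mu (QN i) < +oo. Proof. exact: Qfin. Qed.
Let QlevN N : laminar (QN (N:=N)) (initial lev (N:=N)).
Proof. exact: laminar_initial. Qed.

Let tail0 i j : (0 <= tail_coef lev lam i j)%R.
Proof. by rewrite /tail_coef; case: ifP. Qed.

Let tail_le i j : (tail_coef lev lam i j <= lam j)%R.
Proof. by rewrite /tail_coef; case: ifP. Qed.

Lemma tail_le_sum i x : tl i x <= f x.
Proof. by apply: le_wsum => j; [exact: tail0|exact: tail_le]. Qed.

Lemma tail_antitone i j x : (lev i <= lev j)%R -> tl j x <= tl i x.
Proof.
move=> ij; apply: le_wsum => k; first exact: tail0.
rewrite /tail_coef; have [jk|_] := boolP (lev j <= lev k)%R.
  by rewrite (le_trans ij jk).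
by case: ifP.
Qed.

Let ge0_le_poweR (p : R) (y z : \bar R) :
  (0 < p)%R -> 0 <= y -> y <= z -> y `^ p <= z `^ p.
Proof.
move=> p0 y0 yz; apply: gt0_ler_poweR; rewrite ?(ltW p0)//.
  by rewrite in_itv/= leey y0.
by rewrite in_itv/= leey (le_trans y0 yz).
Qed.

Let mtl i p : measurable_fun [set: X] (fun x => tl i x `^ p).
Proof. by apply: measurable_wsum_poweR => //; exact: tail0. Qed.

Let mf p : measurable_fun [set: X] (fun x => f x `^ p).
Proof. exact: measurable_wsum_poweR. Qed.

Let tl0 i x : 0 <= tl i x.
Proof. by apply: wsum_ge0; exact: tail0. Qed.

(** Doob's inequality for [f ^ q] with exponent [r / q > 1]; the tails averaged in [al i] are at
    most [f]. *)
Lemma integral_max_average_le N (r : R) : (q < r)%R ->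
  \int[mu]_x (max_over (initial al (N:=N)) 0 (members (QN (N:=N)) x) `^ (r / q))%:E
  <= (doob_const (r / q))%:E * \int[mu]_x (f x `^ r).
Proof.
move=> qr.
have rq1 : (1 < r / q)%R by rewrite ltr_pdivlMr// mul1r.
have -> : \int[mu]_x (f x `^ r) = \int[mu]_x ((f x `^ q) `^ (r / q)).
  apply: eq_integral => x _; rewrite -poweRrM; congr (_ `^ _).
  by rewrite mulrC divfK// gt_eqF.
apply: (doob_maximal (QlevN N)) => //.
- by move=> i; exact: (ltW (al0 i)).
- by move=> x; exact: poweR_ge0.
- move=> i; rewrite /initial al_average; apply: ge0_le_integral => //.
  + by move=> x _; exact: poweR_ge0.
  + exact: measurable_funTS.
  + exact: measurable_funTS.
  + by move=> x _; apply: ge0_le_poweR => //; exact: tail_le_sum.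
Qed.

Let mFN N (c : nat -> R) p : measurable_fun [set: X]
  (fun x => ((\sum_(i in members (QN (N:=N)) x) c i) `^ p)%:E).
Proof. exact: measurable_initial_sum. Qed.

Let le_al_max N (x : X) (i : 'I_N) : i \in members (QN (N:=N)) x ->
  (al i <= max_over (initial al (N:=N)) 0 (members (QN (N:=N)) x))%R.
Proof. by move=> xi; exact: (le_max_over (initial al (N:=N))). Qed.

Lemma upper_bound_pos (r tau : R) : (q < r)%R -> (0 < tau < r)%R ->
  \int[mu]_x (wsum (fun i => lam i * al i `^ (q^-1 * (r / tau - 1)))%R Q x `^ tau)
  <= (upper_const q r)%:E * \int[mu]_x (f x `^ r).
Proof.
move=> qr /andP[tau0 taur].
have r0 : (0 < r)%R by exact: lt_trans taur.
have s0 : (0 <= q^-1 * (r / tau - 1))%R.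
  by rewrite mulr_ge0 ?invr_ge0 ?(ltW q0)// subr_ge0 ler_pdivlMr// mul1r ltW.
apply: integral_wsum_poweR_le => //.
  by move=> i; rewrite mulr_ge0 ?powR_ge0.
move=> N; pose M x := max_over (initial al (N:=N)) 0 (members (QN (N:=N)) x).
have M0 x : (0 <= M x)%R by exact: max_over_ge.
have mM : measurable_fun [set: X] (fun x => (M x `^ (r / q))%:E).
  exact: (@measurable_fun_members _ _ _ _ (mQN (N:=N)) _ _
    (fun S => (max_over (initial al (N:=N)) 0 S `^ (r / q))%:E)).
apply: (@le_trans _ _ (\int[mu]_x
   (((\sum_(i in members (QN (N:=N)) x) lam i) `^ r)%:E
    + (M x `^ (r / q))%:E))).
  apply: ge0_le_integral => //.
  - by move=> x _; rewrite lee_fin powR_ge0.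
  - exact: (mFN N (fun i => lam i * al i `^ (q^-1 * (r / tau - 1)))%R tau).
  - by apply: emeasurable_funD.
  move=> x _; rewrite lee_fin.
  set S := members _ x.
  have F0 : (0 <= \sum_(i in S) lam i)%R by exact: sumr_ge0.
  apply: (@le_trans _ _ (((\sum_(i in S) lam i)
      * M x `^ (q^-1 * (r / tau - 1))) `^ tau)%R).
    rewrite ge0_ler_powR ?nnegrE ?(ltW tau0)//.
    - by apply: sumr_ge0 => i _; rewrite mulr_ge0 ?powR_ge0.
    - by rewrite mulr_ge0 ?powR_ge0.
    rewrite mulr_suml; apply: ler_sum => i xi; rewrite ler_wpM2l//.
    by rewrite ge0_ler_powR ?nnegrE ?(ltW (al0 _))//; exact: le_al_max.
  (* The product becomes the power [tau] of the sum times the power [r - tau] of [M ^ (1 / q)];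
     [powR_mul_le] separates them. *)
  rewrite powRM ?powR_ge0// -powRrM.
  have -> : (q^-1 * (r / tau - 1) * tau = q^-1 * (r - tau))%R.
    by field; rewrite !gt_eqF.
  rewrite [(r / q)%R]mulrC !(powRrM _ q^-1).
  by apply: powR_mul_le; rewrite ?powR_ge0 ?tau0.
rewrite ge0_integralD//; last 2 first.
- by move=> x _; rewrite lee_fin powR_ge0.
- by move=> x _; rewrite lee_fin powR_ge0.
rewrite /upper_const EFinD ge0_muleDl ?lee_fin//; last first.
  by rewrite ltW// doob_const_gt0// ltr_pdivlMr// mul1r.
rewrite mul1e leeD//; last exact: integral_max_average_le.
exact: integral_initial_sum_le.
Qed.

Definition typical (i : nat) : set X :=
  Q i `&` [set x | tl i x `^ q <= (2 * al i)%:E].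

Lemma measurable_typical i : measurable (typical i).
Proof.
apply: emeasurable_fun_infty_c => //.
exact: measurable_funTS.
Qed.

(** Markov's inequality: the part of [Q i] where [tl i ^ q] exceeds twice its average [al i] has at
    most half the measure. *)
Lemma measure_typical i : mu (Q i) <= 2%:E * mu (typical i).
Proof.
pose B := Q i `&` [set x | (2 * al i)%:E < tl i x `^ q].
have mB : measurable B.
  by apply: emeasurable_fun_o_infty => //; exact: measurable_funTS.
have QE : Q i = typical i `|` B.
  apply/seteqP; split => [x Qx|x [] []//].
  by have [?|?] := leP (tl i x `^ q) (2 * al i)%:E; [left|right].
have disj : typical i `&` B = set0.
  apply/seteqP; split => // x [[_ /=]] + [_ /=].
  by move=> /le_lt_trans H /H; rewrite ltxx.
have muQE : mu (Q i) = mu (typical i) + mu B.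
  by rewrite QE measureU//; exact: measurable_typical.
have fin A : measurable A -> A `<=` Q i -> mu A \is a fin_num.
  move=> mA AQ; rewrite ge0_fin_numE//; apply: le_lt_trans (Qfin i).
  by apply: le_measure; rewrite ?inE.
have tfin : mu (typical i) \is a fin_num.
  by apply: fin; [exact: measurable_typical|move=> x []].
have Bfin : mu B \is a fin_num by apply: fin => // x [].
have : (2 * al i)%:E * mu B <= (al i)%:E * mu (Q i).
  rewrite al_average -integral_cst//.
  apply: (@le_trans _ _ (\int[mu]_(x in B) (tl i x `^ q))).
    apply: ge0_le_integral => //.
    - by move=> x _; rewrite lee_fin mulr_ge0// ltW.
    - exact: measurable_funTS.
    - by move=> x [_ /ltW].
  apply: ge0_subset_integral => //.
  - exact: measurable_funTS.
  - by move=> x _; exact: poweR_ge0.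
  - by move=> x [].
rewrite muQE -(fineK tfin) -(fineK Bfin) -EFinD -!EFinM !lee_fin => H.
have := al0 i; rewrite -(ler_pM2l (al0 i)).
by rewrite mulrDr in H *; lra.
Qed.

(** [S] is left free because one bound below takes the typical sets through [x] and another takes
    all sets through [x]. *)
Lemma tail_typical N (x : X) (i : 'I_N) (S : {set 'I_N}) :
  typical i x -> S \subset members (QN (N:=N)) x ->
  (\sum_(j in S | (lev i <= lev j)%R) lam j <= (2 * al i) `^ q^-1)%R.
Proof.
move=> [Qx /= tq] /fintype.subsetP SQ.
have T0 : (0 <= \sum_(j in S | (lev i <= lev j)%R) lam j)%R.
  exact: sumr_ge0.
have Tt : (\sum_(j in S | (lev i <= lev j)%R) lam j)%:E <= tl i x.
  apply: le_trans (initial_sum_le_wsum _ N _ (tail0 i)).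
  rewrite lee_fin big_mkcond [leRHS]big_mkcond/=; apply: ler_sum => j _.
  rewrite /tail_coef; case: (boolP (j \in S)) => [/SQ ->//|_ /=].
  by case: ifP => //; case: ifP.
have := le_trans (ge0_le_poweR q0 _ Tt) tq.
rewrite lee_fin poweR_EFin lee_fin => /(_ T0) H.
have {H} := ge0_ler_powR (ltW (_ : 0 < q^-1)%R) (powR_ge0 _ _)
  (_ : (2 * al i)%R \in Num.nneg) H.
rewrite -powRrM mulfV ?gt_eqF// powRr1//; apply.
- by rewrite invr_gt0.
- by rewrite nnegrE mulr_ge0// ltW.
Qed.

Let typN N := initial typical (N:=N).

Let typ_members N x : members (typN (N:=N)) x \subset members (QN (N:=N)) x.
Proof.
by apply/fintype.subsetP => i; rewrite !in_members !inE => -[].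
Qed.

(** With reversed levels the segments in [chain_powR_le] and [chain_powR_ge] are the tails, that is,
    partial sums from the smallest sets upwards. *)
Let oppr_lev_inj N x :
  {in members (QN (N:=N)) x &, injective (fun i : 'I_N => - lev i)%R}.
Proof.
move=> i j iQ jQ /oppr_inj; exact: (laminar_lev_inj (QlevN N) iQ jQ).
Qed.

Let integral_typical_le N (c : nat -> R) p : (0 < p)%R ->
  (forall i, 0 <= c i)%R ->
  \int[mu]_x ((\sum_(i in members (QN (N:=N)) x) c i) `^ p)%:E <=
  (large_const p)%:E *
  \int[mu]_x ((\sum_(i in members (typN (N:=N)) x) c i) `^ p)%:E.
Proof.
move=> p0 c0.
apply: (integral_sum_large_subsets (QlevN N) (mQN (N:=N)) (QfinN (N:=N))
  (c := fun i : 'I_N => c i)) => //.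
- by move=> i; exact: measurable_typical.
- by move=> i x [].
- by move=> i; exact: measure_typical.
Qed.

Definition lower_pos_const (r tau : R) : R :=
  (large_const r * ((1 + r / tau) * 2 `^ (q^-1 * (r / tau - 1))) `^ tau)%R.

(** The [lam i] are first moved to the typical sets. There summation by parts from the smallest sets
    leaves [lam i] times a tail to the positive power [r / tau - 1], and the tail is at most
    [(2 * al i) ^ (1 / q)]. Enlarging the typical sets back to [Q i] only increases the sum. *)
Lemma lower_bound_pos (r tau : R) : (0 < tau < r)%R ->
  \int[mu]_x (f x `^ r) <= (lower_pos_const r tau)%:E *
  \int[mu]_x (wsum (fun i => lam i * al i `^ (q^-1 * (r / tau - 1)))%R Q x `^ tau).
Proof.
move=> /andP[tau0 taur].
have r0 : (0 < r)%R by exact: lt_trans taur.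
have rt1 : (1 < r / tau)%R by rewrite ltr_pdivlMr// mul1r.
have rt0 := lt_trans ltr01 rt1.
set sx := (q^-1 * (r / tau - 1))%R.
have s0 : (0 <= sx)%R.
  by rewrite mulr_ge0 ?invr_ge0 ?(ltW q0)// subr_ge0 ltW.
set b := fun i => (lam i * al i `^ sx)%R.
have b0 i : (0 <= b i)%R by rewrite mulr_ge0 ?powR_ge0.
set K := ((1 + r / tau) * 2 `^ sx)%R.
have K0 : (0 <= K)%R by rewrite mulr_ge0 ?powR_ge0// addr_ge0// ltW.
apply: integral_wsum_poweR_le => // N.
apply: (le_trans (integral_typical_le N r0 lam0)).
rewrite /lower_pos_const EFinM -muleA.
rewrite lee_wpmul2l ?lee_fin ?(ltW (large_const_gt0 _))//.
apply: (@le_trans _ _ ((K `^ tau)%:E *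
  \int[mu]_x ((\sum_(i in members (QN (N:=N)) x) b i) `^ tau)%:E)); last first.
  rewrite lee_wpmul2l ?lee_fin ?powR_ge0//.
  exact: integral_initial_sum_le.
rewrite -ge0_integralZl_EFin ?powR_ge0//; last first.
  by move=> x _; rewrite lee_fin powR_ge0.
apply: ge0_le_integral => //.
- by move=> x _; rewrite lee_fin powR_ge0.
- apply: (measurable_initial_sum _ (E := typical)) => //.
  exact: measurable_typical.
- by apply: measurable_funeM; exact: mFN.
move=> x _; rewrite -EFinM lee_fin.
set S := members (typN (N:=N)) x.
have SQ : S \subset members (QN (N:=N)) x by exact: typ_members.
have -> : r = (r / tau * tau)%R by rewrite divfK// gt_eqF.
rewrite powRrM -powRM ?sumr_ge0//.
rewrite ge0_ler_powR ?nnegrE ?(ltW tau0) ?powR_ge0 ?(mulr_ge0 K0) ?sumr_ge0//.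
have injS : {in S &, injective (fun i : 'I_N => - lev i)%R}.
  by move=> i j /(fintype.subsetP SQ) iQ /(fintype.subsetP SQ) jQ;
    exact: (oppr_lev_inj iQ jQ).
apply: (le_trans (chain_powR_le injS rt0 (fun i => lam0 i))).
rewrite /K -mulrA ler_wpM2l//; first by rewrite addr_ge0// ltW.
rewrite mulr_sumr.
apply: (@le_trans _ _ (\sum_(i in S) 2 `^ sx * b i)%R); last first.
  rewrite big_mkcond [leRHS]big_mkcond/=; apply: ler_sum => i _.
  case: ifPn => [/(fintype.subsetP SQ) ->//|_].
  by case: ifP => // _; rewrite mulr_ge0 ?powR_ge0.
apply: ler_sum => i iS; rewrite /b mulrCA ler_wpM2l//.
rewrite -powRM ?(ltW (al0 _))// /sx powRrM.
rewrite ge0_ler_powR ?nnegrE ?powR_ge0 ?sumr_ge0 ?subr_ge0 ?(ltW rt1)//.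
under eq_bigl do rewrite lerN2.
apply: (tail_typical (x := x)) => //; move: iS.
by rewrite in_members inE.
Qed.

Definition upper_neg_const (r tau : R) : R :=
  (large_const tau * (2 `^ (- (q^-1 * (r / tau - 1))) * (1 + (r / tau)^-1)) `^ tau)%R.

(** Here the weights with the power of [al i] are moved to the typical sets. As [r / tau - 1 < 0],
    the bound on the tail turns into an upper bound for that power, and [chain_powR_ge] sums the
    terms over all sets through the point. *)
Lemma upper_bound_neg (r tau : R) : (0 < r < tau)%R ->
  \int[mu]_x (wsum (fun i => lam i * al i `^ (q^-1 * (r / tau - 1)))%R Q x `^ tau)
  <= (upper_neg_const r tau)%:E * \int[mu]_x (f x `^ r).
Proof.
move=> /andP[r0 rtau].
have tau0 : (0 < tau)%R by exact: lt_trans rtau.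
have rt1 : (r / tau < 1)%R by rewrite ltr_pdivrMr// mul1r.
have rt0 : (0 < r / tau)%R by rewrite divr_gt0.
set sx := (q^-1 * (r / tau - 1))%R.
set b := fun i => (lam i * al i `^ sx)%R.
have b0 i : (0 <= b i)%R by rewrite mulr_ge0 ?powR_ge0.
set K := (2 `^ (- sx) * (1 + (r / tau)^-1))%R.
have K0 : (0 <= K)%R by rewrite mulr_ge0 ?powR_ge0// addr_ge0// invr_ge0 ltW.
apply: integral_wsum_poweR_le => // N.
apply: (le_trans (integral_typical_le N tau0 b0)).
rewrite /upper_neg_const EFinM -muleA.
rewrite lee_wpmul2l ?lee_fin ?(ltW (large_const_gt0 _))//.
apply: (@le_trans _ _ ((K `^ tau)%:E *
  \int[mu]_x ((\sum_(i in members (QN (N:=N)) x) lam i) `^ r)%:E)); last first.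
  rewrite lee_wpmul2l ?lee_fin ?powR_ge0//.
  exact: integral_initial_sum_le.
rewrite -ge0_integralZl_EFin ?powR_ge0//; last first.
  by move=> x _; rewrite lee_fin powR_ge0.
apply: ge0_le_integral => //.
- by move=> x _; rewrite lee_fin powR_ge0.
- apply: (measurable_initial_sum _ (E := typical)) => //.
  exact: measurable_typical.
- by apply: measurable_funeM; exact: mFN.
move=> x _; rewrite -EFinM lee_fin.
set S := members (typN (N:=N)) x; set S' := members (QN (N:=N)) x.
have SQ : S \subset S' by exact: typ_members.
have -> : ((\sum_(i in S') lam i) `^ r =
    ((\sum_(i in S') lam i) `^ (r / tau)) `^ tau)%R.
  by rewrite -powRrM divfK// gt_eqF.
rewrite -powRM ?powR_ge0//.
rewrite ge0_ler_powR ?nnegrE ?(ltW tau0) ?(mulr_ge0 K0) ?powR_ge0 ?sumr_ge0//.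
have := chain_powR_ge (@oppr_lev_inj N x) rt0 (fun i => lam0 i).
move=> /(ler_wpM2l (powR_ge0 2 (- sx))); rewrite mulrA; apply: le_trans.
rewrite mulr_sumr big_mkcond [leRHS]big_mkcond/=; apply: ler_sum => i _.
have term0 : (0 <= 2 `^ (- sx) * (lam i *
    (\sum_(j in S' | - lev j <= - lev i) lam j) `^ (r / tau - 1)))%R.
  by rewrite !mulr_ge0 ?powR_ge0.
case: ifPn => iS; last by case: ifP.
rewrite (fintype.subsetP SQ i iS).
(* A nonzero [lam i] makes the tail positive, as the comparison of negative powers requires. *)
have [li|li] := eqVneq (lam i) 0%R; first by rewrite /b li !(mul0r, mulr0).
rewrite mulrCA ler_wpM2l//.
under eq_bigl do rewrite lerN2.
have alE : (al i `^ sx = 2 `^ (- sx) * ((2 * al i) `^ q^-1) `^ (r / tau - 1))%R.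
  rewrite -powRrM -/sx powRM ?(ltW (al0 _))// mulrA -powRD ?pnatr_eq0 ?implybT//.
  by rewrite addNr powRr0 mul1r.
rewrite alE ler_wpM2l ?powR_ge0// powR_antitone//.
- rewrite (bigD1 i)/=; last by rewrite (fintype.subsetP SQ i iS) lexx.
  by rewrite ltr_pwDl ?sumr_ge0// lt_neqAle eq_sym li lam0.
- apply: (tail_typical (x := x)) => //; move: iS.
  by rewrite in_members inE.
- by rewrite subr_le0 ltW.
Qed.

(* Young's inequality and Kolmogorov's inequality for
   [f_i <= G * S `^ (- s)], where [S] is the maximal function of the averages
   over the cubes in [Q i] and [s < 0] is the exponent in [G], bound the average
   over [Q i] a priori, without assuming that [f] has a finite integral. *)
Lemma average_le_local_sum (r tau t : R) (i : nat) :
  (0 < q / t < r / tau)%R -> (r / tau < 1)%R ->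
  (al i `^ (r / tau / (q / t)))%:E * mu (Q i) <=
  (average_const (q / t) (r / tau))%:E * \int[mu]_(x in Q i)
   (wsum (fun i => lam i * al i `^ (q^-1 * (r / tau - 1)))%R Q x `^ t).
Proof.
set th := (q / t)%R; set rho := (r / tau)%R => /andP[th0 thrho] rho1.
have th1 : (th < 1)%R by exact: lt_trans rho1.
have t0 : (0 < t)%R by move: th0; rewrite /th pmulr_rgt0// invr_gt0.
(* Then [k * (1 - th) = 1 - rho = - sx * q], the power of [S] in the [q]-th power of
   [G * S ^ (- sx)]; and [k < 1] amounts to [th < rho]. *)
set k := ((1 - rho) / (1 - th))%R.
have k01 : (0 < k < 1)%R.
  rewrite divr_gt0 ?subr_gt0//= ltr_pdivrMr ?subr_gt0// mul1r.
  by rewrite ltrD2l ltrN2.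
have K0 := kolmogorov_const_gt0 k01.
set K := kolmogorov_const k in K0.
set sx := (q^-1 * (rho - 1))%R.
set b := fun i => (lam i * al i `^ sx)%R.
have b0 j : (0 <= b j)%R by rewrite mulr_ge0 ?powR_ge0.
set G := wsum b Q.
have mG p : measurable_fun [set: X] (fun x => G x `^ p).
  exact: measurable_wsum_poweR.
(* Kolmogorov's bound contributes [e * K * al i ^ k], which this choice makes equal to
   [al i / 2]. *)
set e := ((2 * K)^-1 * al i `^ (1 - k))%R.
have e0 : (0 < e)%R by rewrite mulr_gt0 ?powR_gt0// invr_gt0 mulr_gt0.
(* Sets not inside [Q i] are emptied. For those kept, the level condition gives [tl j <= tl i], so
   the single function [tl i ^ q] dominates all the averaged ones. *)
pose Q' N := fun j : 'I_N =>
  if (lev i <= lev j)%R && `[< Q j `<=` Q i >] then Q j else set0.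
have mQ' N j : measurable (Q' N j) by rewrite /Q'; case: ifP.
have Q'lev N : laminar (Q' N) (initial lev (N:=N)).
  split => [j l x|j l x]; rewrite /Q'; case: ifP => // _; case: ifP => // _.
    exact: ((QlevN N).1 j l x).
  exact: ((QlevN N).2 j l x).
have kolm N : \int[mu]_(x in Q i)
    (max_over (initial al (N:=N)) (al i) (members (Q' N) x) `^ k)%:E <=
    (K * al i `^ k)%:E * mu (Q i).
  apply: (kolmogorov_maximal (Q'lev N) (mQ' N) (g := fun x => tl i x `^ q)) => //.
  - by move=> j; exact: (ltW (al0 j)).
  - by move=> j; rewrite /Q'; case: ifP => [/andP[_ /asboolP]//|_]; exact: sub0set.
  - by move=> x; exact: poweR_ge0.
  - move=> j; rewrite /Q'; case: ifPn => [/andP[ij _]|_]; last first.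
      by rewrite measure0 mule0 integral_set0.
    rewrite al_average; apply: ge0_le_integral => //.
    + by move=> x _; exact: poweR_ge0.
    + exact: measurable_funTS.
    + exact: measurable_funTS.
    + by move=> x _; apply: ge0_le_poweR => //; exact: tail_antitone.
  - by rewrite al_average.
set W := (e `^ (- ((1 - th) / th)))%R.
have W0 : (0 < W)%R by rewrite powR_gt0.
have main : (al i)%:E * mu (Q i) <=
    W%:E * \int[mu]_(x in Q i) (G x `^ t) + (al i / 2)%:E * mu (Q i).
  rewrite {1}al_average; apply: integral_wsum_poweR_le => //.
  move=> N; pose S x := max_over (initial al (N:=N)) (al i) (members (Q' N) x).
  have S0 x : (0 < S x)%R by apply: (lt_le_trans (al0 i)); exact: max_over_ge.
  have mS : measurable_fun [set: X] (fun x => (S x `^ k)%:E).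
    exact: (@measurable_fun_members _ _ _ _ (mQ' N) _ _
      (fun B => (max_over (initial al (N:=N)) (al i) B `^ k)%:E)).
  apply: (@le_trans _ _ (\int[mu]_(x in Q i)
      (W%:E * G x `^ t + e%:E * (S x `^ k)%:E))).
    apply: ge0_le_integral => //.
    - by move=> x _; rewrite lee_fin powR_ge0.
    - by apply: measurable_funTS; exact: mFN.
    - apply: emeasurable_funD; apply: measurable_funeM; exact: measurable_funTS.
    move=> x Qx.
    set A := members _ x.
    set GN := (\sum_(j in A) b j)%R.
    have GN0 : (0 <= GN)%R by exact: sumr_ge0.
    have GNG : GN%:E <= G x by exact: initial_sum_le_wsum.
    apply: (@le_trans _ _ (W * GN `^ t + e * S x `^ k)%:E); last first.
      rewrite EFinD !EFinM leeD2r// lee_wpmul2l ?lee_fin ?(ltW W0)//.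
      by rewrite -poweR_EFin; apply: ge0_le_poweR.
    rewrite lee_fin.
    have young := @powR_young_eps R (GN `^ t) (S x `^ k) th e
      (powR_ge0 _ _) (powR_ge0 _ _).
    rewrite th0 th1 in young; apply: le_trans (young isT e0).
    rewrite -!powRrM.
    have -> : (t * th = q)%R by rewrite /th mulrC divfK// gt_eqF.
    have -> : (k * (1 - th) = - sx * q)%R.
      by rewrite /k /sx; field; rewrite !gt_eqF// subr_gt0.
    rewrite (powRrM (S x) (- sx) q).
    rewrite -(@powRM R GN (S x `^ (- sx)) q GN0 (powR_ge0 _ _)).
    rewrite ge0_ler_powR ?nnegrE ?(ltW q0) ?(mulr_ge0 GN0) ?powR_ge0 ?sumr_ge0//.
    rewrite mulr_suml; apply: ler_sum => j jA.
    rewrite /tail_coef; case: ifPn => ij; last by rewrite mulr_ge0 ?powR_ge0.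
    rewrite /b -mulrA -[leLHS]mulr1 ler_wpM2l//.
    rewrite powRN ler_pdivlMr ?powR_gt0// mul1r.
    apply: powR_antitone => //; last first.
      by rewrite pmulr_rle0 ?invr_gt0// subr_le0 ltW.
    have Qjx : Q j x by move: jA; rewrite in_members inE.
    have jQ' : j \in members (Q' N) x.
      rewrite in_members /Q' ij/= asboolT ?inE//.
      exact: (Qlev.1 i j x).
    exact: (le_max_over (initial al (N:=N)) _ jQ').
  rewrite ge0_integralD//; last 4 first.
  - by move=> x _; rewrite mule_ge0 ?poweR_ge0// lee_fin ltW.
  - by apply: measurable_funeM; exact: measurable_funTS.
  - by move=> x _; rewrite mule_ge0 ?lee_fin ?powR_ge0// ltW.
  - by apply: measurable_funeM; exact: measurable_funTS.
  rewrite ge0_integralZl_EFin//; last 3 first.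
  - by move=> x _; exact: poweR_ge0.
  - exact: measurable_funTS.
  - exact: ltW.
  rewrite leeD2l// ge0_integralZl_EFin//; last 3 first.
  - by move=> x _; rewrite lee_fin powR_ge0.
  - exact: measurable_funTS.
  - exact: ltW.
  apply: (@le_trans _ _ (e%:E * ((K * al i `^ k)%:E * mu (Q i)))).
    by rewrite lee_wpmul2l ?lee_fin ?(ltW e0)//; exact: kolm.
  rewrite muleA -EFinM lee_wpmul2r// lee_fin le_eqVlt; apply/orP; left.
  have alk : (al i `^ (1 - k) * al i `^ k = al i)%R.
    rewrite -powRD ?subrK ?(gt_eqF (al0 i)) ?implybT//.
    exact/powRr1/ltW.
  by rewrite /e mulrACA alk; apply/eqP; field; rewrite gt_eqF.
(* Half of [al i * mu (Q i)] can be subtracted because [al i] is real and [Q i] has finite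
   measure. *)
have {main} main : (al i)%:E * mu (Q i) <=
    (2 * W)%:E * \int[mu]_(x in Q i) (G x `^ t).
  have mufin : mu (Q i) \is a fin_num by rewrite ge0_fin_numE.
  have J0 : 0 <= \int[mu]_(x in Q i) (G x `^ t).
    by apply: integral_ge0 => x _; exact: poweR_ge0.
  case: (\int[mu]_(x in Q i) (G x `^ t)) J0 main => [J _|_ _|//]; last first.
    by rewrite gt0_muley ?leey// lte_fin mulr_gt0.
  rewrite -(fineK mufin) -!EFinM -EFinD !lee_fin => main.
  by rewrite -mulrA; lra.
(* [W] contains the power [1 - rho / th] of [al i], since [(1 - k) * (1 - th) = rho - th]; this
   factor cancels it. *)
set u := (al i `^ (rho / th - 1))%R.
have u0 : (0 < u)%R by rewrite powR_gt0.
have -> : (al i `^ (rho / th) = u * al i)%R.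
  by rewrite [RHS]mulrC /u powR_mulDB1 ?(ltW (al0 i))// gt_eqF// divr_gt0// (lt_trans th0).
rewrite EFinM -muleA.
apply: (@le_trans _ _ (u%:E * ((2 * W)%:E * \int[mu]_(x in Q i) (G x `^ t)))).
  by rewrite lee_wpmul2l ?lee_fin ?(ltW u0).
rewrite muleA -EFinM lee_wpmul2r ?lee_fin//.
  by apply: integral_ge0 => x _; exact: poweR_ge0.
rewrite /average_const -/k -/K /W /e powRM ?powR_ge0//; last first.
  by rewrite invr_ge0 mulr_ge0// ltW.
rewrite -powRrM le_eqVlt; apply/orP; left; apply/eqP.
set Z := (_ `^ (- _))%R; set Y := (al i `^ (_ * _))%R.
suff uY : (u * Y = 1)%R by rewrite mulrCA (mulrCA u) uY mulr1.
rewrite /u /Y -powRD ?(gt_eqF (al0 i)) ?implybT//.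
have -> : (rho / th - 1 + (1 - k) * - ((1 - th) / th) = 0)%R.
  rewrite /k; field; rewrite !gt_eqF ?subr_gt0//.
by rewrite powRr0.
Qed.

Definition lower_neg_const (r tau : R) : R :=
  let t := ((tau * (q / r) + tau) / 2)%R in
  (1 + doob_const (tau / t) * average_const (q / t) (r / tau) `^ (tau / t))%R.

Lemma lower_bound_neg (r tau : R) : (q < r)%R -> (r < tau)%R ->
  \int[mu]_x (f x `^ r) <= (lower_neg_const r tau)%:E *
  \int[mu]_x (wsum (fun i => lam i * al i `^ (q^-1 * (r / tau - 1)))%R Q x `^ tau).
Proof.
move=> qr rtau; rewrite /lower_neg_const.
(* A midpoint: [t < tau] makes the Doob exponent [tau / t] exceed 1, and [t > tau * (q / r)] says
   [q / t < r / tau], as [average_le_local_sum] requires. *)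
set t := ((tau * (q / r) + tau) / 2)%R.
have r0 : (0 < r)%R by exact: lt_trans qr.
have tau0 : (0 < tau)%R by exact: lt_trans rtau.
have qr1 : (q / r < 1)%R by rewrite ltr_pdivrMr// mul1r.
have qr0 : (0 < q / r)%R by rewrite divr_gt0.
have ttau : (t < tau)%R.
  have : (tau * (q / r) < tau * 1)%R by rewrite ltr_pM2l.
  by rewrite /t; lra.
have tqr : (tau * (q / r) < t)%R.
  have : (tau * (q / r) < tau * 1)%R by rewrite ltr_pM2l.
  by rewrite /t; lra.
have t0 : (0 < t)%R by apply: lt_trans tqr; rewrite mulr_gt0.
have rt1 : (r / tau < 1)%R by rewrite ltr_pdivrMr// mul1r.
have rt0 : (0 < r / tau)%R by rewrite divr_gt0.
have thrho : (0 < q / t < r / tau)%R.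
  rewrite divr_gt0//= ltr_pdivrMr// -(ltr_pM2l rt0) in tqr *.
  by move: tqr; congr (_ < _)%R; field; rewrite !gt_eqF.
have p1 : (1 < tau / t)%R by rewrite ltr_pdivlMr// mul1r.
set p := (tau / t)%R in p1 *.
set Ka := average_const _ _.
have Ka0 : (0 <= Ka)%R by rewrite /Ka /average_const mulr_ge0 ?powR_ge0.
set sx := (q^-1 * (r / tau - 1))%R.
have s0 : (sx <= 0)%R by rewrite pmulr_rle0 ?invr_gt0// subr_le0 ltW.
set b := fun i => (lam i * al i `^ sx)%R.
have b0 j : (0 <= b j)%R by rewrite mulr_ge0 ?powR_ge0.
set G := wsum b Q.
have mG s : measurable_fun [set: X] (fun x => G x `^ s).
  exact: measurable_wsum_poweR.
set ex := (r / tau / (q / t))%R.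
have ex0 : (0 < ex)%R by rewrite divr_gt0// divr_gt0.
apply: integral_wsum_poweR_le => // N.
pose a := fun i : 'I_N => (al i `^ ex)%R.
pose A x := max_over a 0 (members (QN (N:=N)) x).
have A0 x : (0 <= A x)%R by exact: max_over_ge.
have mA : measurable_fun [set: X] (fun x => (A x `^ p)%:E).
  exact: (@measurable_fun_members _ _ _ _ (mQN (N:=N)) _ _
    (fun S => (max_over a 0 S `^ p)%:E)).
have doob : \int[mu]_x (A x `^ p)%:E <=
    (doob_const p * Ka `^ p)%:E * \int[mu]_x (G x `^ tau).
  have -> : (doob_const p * Ka `^ p)%:E * \int[mu]_x (G x `^ tau) =
      (doob_const p)%:E * \int[mu]_x ((Ka%:E * G x `^ t) `^ p).
    rewrite EFinM -muleA -ge0_integralZl_EFin ?powR_ge0//; last first.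
      by move=> x _; exact: poweR_ge0.
    congr (_ * _); apply: eq_integral => x _.
    rewrite poweRM ?lee_fin ?poweR_ge0// poweR_EFin -poweRrM; congr (_ * _ `^ _).
    by rewrite /p mulrC divfK// gt_eqF.
  apply: (doob_maximal (QlevN N)) => //.
  - by move=> i; exact: powR_ge0.
  - by move=> x; rewrite mule_ge0 ?poweR_ge0// lee_fin.
  - exact: measurable_funeM.
  - move=> i; rewrite ge0_integralZl_EFin//; last 2 first.
    + by move=> x _; exact: poweR_ge0.
    + exact: measurable_funTS.
    exact: average_le_local_sum.
apply: (@le_trans _ _ (\int[mu]_x
   (((\sum_(i in members (QN (N:=N)) x) b i) `^ tau)%:E + (A x `^ p)%:E))).
  apply: ge0_le_integral => //.
  - by move=> x _; rewrite lee_fin powR_ge0.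
  - by apply: emeasurable_funD => //; exact: (mFN N b tau).
  move=> x _; rewrite -EFinD lee_fin.
  set S := members _ x.
  have G0 : (0 <= \sum_(i in S) b i)%R by exact: sumr_ge0.
  (* [A] is the maximum of the powers [al i ^ ex], so [M] is the maximum of the [al i]
     themselves. *)
  pose M := (A x `^ ex^-1)%R.
  have M0 : (0 <= M)%R by exact: powR_ge0.
  have alM i : i \in S -> (al i <= M)%R.
    move=> iS; rewrite /M.
    rewrite -[leLHS](powRr1 (ltW (al0 i))) -(mulfV (lt0r_neq0 ex0)) powRrM.
    rewrite ge0_ler_powR ?nnegrE ?invr_ge0 ?(ltW ex0) ?powR_ge0//.
    exact: (le_max_over a _ iS).
  have FG : (\sum_(i in S) lam i <= (\sum_(i in S) b i) * M `^ (- sx))%R.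
    rewrite mulr_suml; apply: ler_sum => i iS.
    have Mi : (0 < M)%R by apply: (lt_le_trans (al0 i)); exact: alM.
    rewrite /b -mulrA -[leLHS]mulr1 ler_wpM2l//.
    rewrite powRN ler_pdivlMr; last by rewrite powR_gt0.
    rewrite mul1r.
    by apply: powR_antitone => //; exact: alM.
  apply: (@le_trans _ _ (((\sum_(i in S) b i) * M `^ (- sx)) `^ r)%R).
    by rewrite ge0_ler_powR ?nnegrE ?(ltW r0) ?(mulr_ge0 G0) ?powR_ge0 ?sumr_ge0.
  (* As [r < tau], [powR_mul_le] is applied with the exponents [r] and [tau - r]; the base
     [M ^ (r / q / tau)] is such that its power [tau] is [A ^ p]. *)
  rewrite powRM ?powR_ge0// -powRrM.
  have -> : (- sx * r = r / q / tau * (tau - r))%R.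
    by rewrite /sx; field; rewrite !gt_eqF.
  have -> : (A x `^ p = (M `^ (r / q / tau)) `^ tau)%R.
    rewrite /M -!powRrM; congr (_ `^ _)%R.
    by rewrite /p /ex; field; rewrite !gt_eqF.
  by rewrite (powRrM M); apply: powR_mul_le; rewrite ?powR_ge0 ?r0.
rewrite ge0_integralD//; last 2 first.
- by move=> x _; rewrite lee_fin powR_ge0.
- by move=> x _; rewrite lee_fin powR_ge0.
rewrite EFinD ge0_muleDl ?lee_fin//; last first.
  by rewrite mulr_ge0 ?powR_ge0// ltW// doob_const_gt0.
rewrite mul1e leeD//.
exact: integral_initial_sum_le.
Qed.

End countable_laminar.

(** * Dyadic cubes *)

Section dyadic_geometry.
Context (R : realType).

Lemma dyadic_interval_nested (k l m m' : int) (x y : R) : k <= l ->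
  m%:~R * 2 ^ (- k) <= x < (m + 1)%:~R * 2 ^ (- k) ->
  m'%:~R * 2 ^ (- l) <= x < (m' + 1)%:~R * 2 ^ (- l) ->
  m'%:~R * 2 ^ (- l) <= y < (m' + 1)%:~R * 2 ^ (- l) ->
  m%:~R * 2 ^ (- k) <= y < (m + 1)%:~R * 2 ^ (- k).
Proof.
move=> kl.
have [j lkj] : exists j : nat, l - k = j%:Z.
  by exists `|l - k|%N; rewrite gez0_abs// subr_ge0.
have h0 : 0 < (2 : R) ^ (- l) by rewrite exprz_gt0.
have -> : (2 : R) ^ (- k) = (2 ^+ j)%:~R * 2 ^ (- l).
  have -> : - k = j%:Z + - l by rewrite -lkj; ring.
  by rewrite expfzDr ?pnatr_eq0// rmorphXn.
rewrite !mulrA -!intrM => /andP[mx xm] /andP[m'x xm'] /andP[m'y ym'].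
(* In units of the finer level all endpoints are integers, so the common point [x] forces these
   non-strict comparisons. *)
have H1 : (m * 2 ^+ j) <= m'.
  by rewrite -ltzD1 -(ltr_int R) -(ltr_pM2r h0) (le_lt_trans mx).
have H2 : m' + 1 <= (m + 1) * 2 ^+ j.
  by rewrite lezD1 -(ltr_int R) -(ltr_pM2r h0) (le_lt_trans m'x).
apply/andP; split.
  by apply: le_trans m'y; rewrite ler_pM2r// ler_int.
by apply: (lt_le_trans ym'); rewrite ler_pM2r// ler_int.
Qed.

Lemma dyadic_interval_eq (k m m' : int) (x : R) :
  m%:~R * 2 ^ (- k) <= x < (m + 1)%:~R * 2 ^ (- k) ->
  m'%:~R * 2 ^ (- k) <= x < (m' + 1)%:~R * 2 ^ (- k) -> m = m'.
Proof.
have h0 : 0 < (2 : R) ^ (- k) by rewrite exprz_gt0.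
move=> /andP[mx xm] /andP[m'x xm'].
apply: le_anti; apply/andP; split.
  by rewrite -ltzD1 -(ltr_int R) -(ltr_pM2r h0) (le_lt_trans mx).
by rewrite -ltzD1 -(ltr_int R) -(ltr_pM2r h0) (le_lt_trans m'x).
Qed.

Variable n : nat.

(** The level is selected by choice among those at which the set is a cube; afterwards the set is
    always represented at this level. *)
Definition dyadic_level (Q : set (borelRn R n)) : int :=
  xget 0 [set k | exists m, Q = dyadic_cube k m].

Lemma dyadic_levelP (Q : set (borelRn R n)) : dyadic_cubes Q ->
  exists m, Q = dyadic_cube (dyadic_level Q) m.
Proof.
move=> [k [m Qkm]]; rewrite /dyadic_level.
by case: xgetP => [l _ //|/(_ k)]; case; exists m.
Qed.

Lemma dyadic_nested (P Q : set (borelRn R n)) (x : borelRn R n) :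
  dyadic_cubes P -> dyadic_cubes Q -> P x -> Q x ->
  dyadic_level P <= dyadic_level Q -> Q `<=` P.
Proof.
move=> /dyadic_levelP[m PE] /dyadic_levelP[m' QE] Px Qx le y Qy.
rewrite PE => i; rewrite PE in Px; rewrite QE in Qx Qy.
exact: (dyadic_interval_nested le (Px i) (Qx i) (Qy i)).
Qed.

Lemma dyadic_eq (P Q : set (borelRn R n)) (x : borelRn R n) :
  dyadic_cubes P -> dyadic_cubes Q -> P x -> Q x ->
  dyadic_level P = dyadic_level Q -> P = Q.
Proof.
move=> /dyadic_levelP[m PE] /dyadic_levelP[m' QE] Px Qx lev.
rewrite PE QE lev; congr dyadic_cube; apply/rowP => i.
rewrite PE lev in Px; rewrite QE in Qx.
exact: (dyadic_interval_eq (Px i) (Qx i)).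
Qed.

Lemma countable_dyadic_cubes : countable (@dyadic_cubes R n).
Proof.
rewrite (_ : @dyadic_cubes R n =
    (fun km : int * 'rV[int]_n => dyadic_cube km.1 km.2) @` setT).
  by apply: (card_le_trans (card_image_le _ _)); exact: countableP.
apply/seteqP; split => [Q [k [m ->]]|Q [[k m] _ <-]]; last by exists k, m.
by exists (k, m).
Qed.

Let open_measurable_borelRn (A : set 'rV[R]_n) :
  open A -> measurable (A : set (borelRn R n)).
Proof. by move=> oA; exact: sub_sigma_algebra. Qed.

Lemma open_coord_lt (i : 'I_n) (a : R) : open [set x : 'rV[R]_n | x ord0 i < a].
Proof.
apply: (@open_comp _ _ (fun x : 'rV[R]_n => x ord0 i) [set y | y < a]).
  by move=> x _; exact: coord_continuous.
exact: open_lt.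
Qed.

Lemma measurable_dyadic_cube (Q : set (borelRn R n)) :
  dyadic_cubes Q -> measurable Q.
Proof.
move=> [k [m ->]].
rewrite (_ : dyadic_cube k m = \bigcap_(i in [set: 'I_n])
    (~` [set x : borelRn R n | (x : 'rV[R]_n) ord0 i < (m ord0 i)%:~R * 2 ^ (- k)]
     `&` [set x : borelRn R n |
           (x : 'rV[R]_n) ord0 i < (m ord0 i + 1)%:~R * 2 ^ (- k)])).
  apply: fin_bigcap_measurable; first exact: finite_finset.
  move=> i _; apply: measurableI.
    by apply: measurableC; apply: open_measurable_borelRn; exact: open_coord_lt.
  by apply: open_measurable_borelRn; exact: open_coord_lt.
apply/seteqP; split => [x Qx i _|x Qx i].
  by have /andP[? ?] := Qx i; split => //=; apply/negP; rewrite -leNgt.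
by have [/= /negP] := Qx i Logic.I; rewrite -leNgt => -> ->.
Qed.

(** The closed box with the same edges is compact, so finitely many open neighbourhoods of finite
    measure cover the cube. *)
Lemma locally_finite_dyadic_cube (sigma : {measure set (borelRn R n) -> \bar R})
    (Q : set (borelRn R n)) :
  locally_finite sigma -> dyadic_cubes Q -> (sigma Q < +oo)%E.
Proof.
move=> lf Qd; have mQ := measurable_dyadic_cube Qd; have [k [m QE]] := Qd.
pose A i : set R :=
  [set` `[(m ord0 i)%:~R * 2 ^ (- k), (m ord0 i + 1)%:~R * 2 ^ (- k)]].
have : compact [set v : 'rV[R]_n | forall i, A i (v ord0 i)].
  by apply: rV_compact => i; exact: segment_compact.
rewrite compact_cover.
have [U HU] : {U : 'rV[R]_n -> set 'rV[R]_n |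
    forall x, open_nbhs x (U x) /\ (sigma (U x) < +oo)%E}.
  have /choice[U HU] : forall x : 'rV[R]_n, exists V : set 'rV[R]_n,
      open_nbhs x V /\ (sigma V < +oo)%E.
    by move=> x; have [V ? ?] := lf x; exists V.
  by exists U.
have mU x : measurable (U x : set (borelRn R n)).
  by apply: open_measurable_borelRn; have [[]] := HU x.
move=> /(_ _ [set: 'rV[R]_n] U)[].
- by move=> x _; have [[]] := HU x.
- by move=> x _; exists x => //; have [[]] := HU x.
move=> D _ cov; pose s := finmap.enum_fset D.
have QD : Q `<=` \big[setU/set0]_(x <- s) U x.
  move=> y Qy; have [|x xD Uxy] := cov y; last first.
    by rewrite -bigcup_seq; exists x.
  move=> i; rewrite QE in Qy; have /andP[? /ltW ?] := Qy i.
  by rewrite /A /= in_itv/=; apply/andP.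
have mUD : measurable (\big[setU/set0]_(x <- s) U x : set (borelRn R n)).
  by apply: bigsetU_measurable => x _; exact: mU.
apply: (@le_lt_trans _ _ (sigma (\big[setU/set0]_(x <- s) U x))).
  by apply: le_measure; rewrite ?inE.
have : (sigma (\big[setU/set0]_(x <- s) U x) <= \sum_(x <- s) sigma (U x))%E.
  elim: s {QD mUD} => [|x s IH]; first by rewrite !big_nil measure0.
  rewrite !big_cons.
  apply: (le_trans (measureU2 _ _ _)) => //.
    by apply: bigsetU_measurable => y _; exact: mU.
  exact: leeD.
move=> /le_lt_trans; apply.
by apply: lte_sum_pinfty => x _; have [] := HU x.
Qed.

End dyadic_geometry.

(** * Laminar families of sets *)

Definition family_sum (X : Type) (R : realType) (J : set (set X))
  (a : set X -> R) (x : X) : \bar R := (\esum_(Q in J) (a Q * \1_Q x)%:E)%E.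

Lemma upper_const_ge0 (R : realType) (q r : R) : 0 <= upper_const q r.
Proof. exact: (addr_ge0 ler01 (powR_ge0 _ _)). Qed.

Lemma lower_pos_const_ge0 (R : realType) (q r tau : R) :
  0 < r -> 0 <= lower_pos_const q r tau.
Proof.
by move=> r0; exact: (mulr_ge0 (ltW (large_const_gt0 r0)) (powR_ge0 _ _)).
Qed.

Lemma upper_neg_const_ge0 (R : realType) (q r tau : R) :
  0 < tau -> 0 <= upper_neg_const q r tau.
Proof.
by move=> tau0; exact: (mulr_ge0 (ltW (large_const_gt0 tau0)) (powR_ge0 _ _)).
Qed.

Lemma lower_neg_const_ge0 (R : realType) (q r tau : R) :
  0 <= lower_neg_const q r tau.
Proof.
exact: (addr_ge0 ler01 (mulr_ge0 (powR_ge0 _ _) (powR_ge0 _ _))).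
Qed.

Definition equivalence_const (R : realType) (q r tau : R) : R :=
  1 + upper_const q r + lower_pos_const q r tau + upper_neg_const q r tau
  + lower_neg_const q r tau.

Lemma equivalence_const_ge (R : realType) (q r tau : R) :
  0 < r -> 0 < tau ->
  [/\ 1 <= equivalence_const q r tau,
      upper_const q r <= equivalence_const q r tau,
      lower_pos_const q r tau <= equivalence_const q r tau,
      upper_neg_const q r tau <= equivalence_const q r tau &
      lower_neg_const q r tau <= equivalence_const q r tau].
Proof.
move=> r0 tau0.
have c1 := upper_const_ge0 q r; have c2 := lower_pos_const_ge0 q tau r0.
have c3 := upper_neg_const_ge0 q r tau0; have c4 := lower_neg_const_ge0 q r tau.
by rewrite /equivalence_const; split; lra.
Qed.

Section laminar_families.
Local Open Scope ereal_scope.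
Context d (X : measurableType d) (R : realType).
Variable mu : {measure set X -> \bar R}.
Variables (J : set (set X)) (level : set X -> int) (a : set X -> R).
Hypothesis mJ : forall Q, J Q -> measurable Q.
Hypothesis Jfin : forall Q, J Q -> mu Q < +oo.
Hypothesis Jpos : forall Q, J Q -> mu Q != 0.
Hypothesis Jnest : forall P Q x, J P -> J Q -> P x -> Q x ->
  (level P <= level Q)%R -> Q `<=` P.
Hypothesis Jeq : forall P Q x, J P -> J Q -> P x -> Q x ->
  level P = level Q -> P = Q.
Hypothesis a0 : forall Q, J Q -> (0 < a Q)%R.

(* The enumeration is indexed by a set [B] of natural numbers as [J] may be
   finite. *)
Variables (B : set nat) (e : nat -> set X).
Hypothesis einj : set_inj B e.
Hypothesis eJ : e @` B = J.

Let eB i : i \in B -> J (e i).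
Proof. by move=> iB; rewrite -eJ; exists i => //; rewrite inE in iB. Qed.

Let esum_enum (h : set X -> \bar R) : (forall Q, J Q -> 0 <= h Q) ->
  \esum_(Q in J) h Q = \sum_(i <oo) if i \in B then h (e i) else 0.
Proof.
move=> h0; rewrite -eseries_mkcond -eJ esum_set_image// => n Bn.
by apply: h0; rewrite -eJ; exists n.
Qed.

Let Q i : set X := if i \in B then e i else set0.
Let lev i := level (e i).
Let coef (c : set X -> R) i : R := if i \in B then c (e i) else 0%R.

Let family_sum_wsum (c : set X -> R) x : (forall P, J P -> 0 <= c P)%R ->
  family_sum J c x = wsum (coef c) Q x.
Proof.
move=> c0; rewrite /family_sum esum_enum; last first.
  by move=> P JP; rewrite lee_fin mulr_ge0// c0.
apply: eq_eseriesr => i _; rewrite /coef /Q; case: ifPn => // _.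
by rewrite mul0r.
Qed.

Let Qlev : laminar Q lev.
Proof.
split=> i j x; rewrite /Q; case: ifPn => // iB; case: ifPn => // jB ix jx ij.
  exact: (Jnest (eB iB) (eB jB) ix jx ij).
apply: einj; rewrite ?inE; rewrite ?inE in iB jB => //.
by apply: (Jeq _ _ ix jx ij); apply: eB; rewrite inE.
Qed.

Let mQ i : measurable (Q i).
Proof. by rewrite /Q; case: ifPn => // /eB/mJ. Qed.

Let Qfin i : mu (Q i) < +oo.
Proof. by rewrite /Q; case: ifPn => [/eB/Jfin//|_]; rewrite measure0. Qed.

Let lam := coef a.

Let lam0 i : (0 <= lam i)%R.
Proof. by rewrite /lam /coef; case: ifPn => // /eB/a0/ltW. Qed.

Definition local_family_sum (P : set X) (x : X) : \bar R :=
  \esum_(Q in J `&` [set Q | Q `<=` P]) (a Q * \1_Q x)%:E.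

Definition local_average (q : R) (P : set X) : \bar R :=
  (mu P)^-1 * \int[mu]_(x in P) (local_family_sum P x `^ q).

Lemma local_family_sum_tail i x : i \in B -> e i x ->
  local_family_sum (e i) x = wsum (tail_coef lev lam i) Q x.
Proof.
move=> iB ix; rewrite /local_family_sum esum_mkcondr esum_enum; last first.
  move=> P JP; case: ifP => // _.
  by rewrite lee_fin mulr_ge0// ltW// a0.
apply: eq_eseriesr => j _; rewrite /tail_coef /lam /coef /Q.
case: ifPn => jB; last by case: ifP; rewrite mul0r.
have [jx|jx] := boolP (x \in e j); last first.
  by rewrite indicE (negbTE jx) !mulr0; case: ifP.
rewrite inE in jx; rewrite (_ : (e j \in _) = (lev i <= lev j)%R).
  by case: ifP => //; rewrite mul0r.
apply/idP/idP => [|ij]; last first.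
  by rewrite inE; exact: (Jnest (eB iB) (eB jB) ix jx ij).
rewrite inE => /= ji; rewrite leNgt; apply/negP => ij.
(* If [e j] inside [e i] had strictly lower level, nesting would give the reverse inclusion, hence
   equal sets and equal levels. *)
have ij' := Jnest (eB jB) (eB iB) jx ix (ltW ij).
have E : e i = e j by apply/seteqP; split.
by rewrite /lev E ltxx in ij.
Qed.

Let tail0 i j : (0 <= tail_coef lev lam i j)%R.
Proof. by rewrite /tail_coef; case: ifP. Qed.

Let muV P : J P -> exists m : R, [/\ (0 < m)%R, mu P = m%:E & (mu P)^-1 = (m^-1)%:E].
Proof.
move=> JP; have : mu P \is a fin_num by rewrite ge0_fin_numE// Jfin.
move=> fin; exists (fine (mu P)).
have Pfine : fine (mu P) != 0%R.
  by rewrite -(@eqe R) fineK//; exact: Jpos.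
split; rewrite ?fineK//; first by rewrite lt_neqAle eq_sym Pfine fine_ge0.
by rewrite -[in LHS](fineK fin) inver (negbTE Pfine).
Qed.

(** On [P] the local sum contains the term [a P], so the average is at least [a P ^ q]. *)
Lemma local_average_gt0 q P : J P -> (0 < q)%R -> 0 < local_average q P.
Proof.
move=> JP q0; have [i iB eP] : exists2 i, i \in B & e i = P.
  by move: (JP); rewrite -eJ => -[i Bi <-]; exists i => //; rewrite inE.
have [m [m0 muP muPV]] := muV JP; have mP := mJ JP.
rewrite /local_average muPV mule_gt0 ?lte_fin ?invr_gt0//.
apply: (@lt_le_trans _ _ (\int[mu]_(x in P) ((a P) `^ q)%:E)).
  by rewrite integral_cst// muP -EFinM lte_fin mulr_gt0// powR_gt0// a0.
apply: ge0_le_integral => //.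
- by move=> x _; rewrite lee_fin powR_ge0.
- rewrite -eP; apply: (@eq_measurable_fun _ _ _ _ _
     (fun x => wsum (tail_coef lev lam i) Q x `^ q)).
    by move=> x; rewrite inE => ix; rewrite local_family_sum_tail.
  apply: measurable_funTS; exact: measurable_wsum_poweR.
move=> x Px; rewrite -poweR_EFin; apply: gt0_ler_poweR.
- exact: ltW.
- by rewrite in_itv/= leey lee_fin ltW// a0.
- rewrite in_itv/= leey andbT; apply: esum_ge0 => S [JS _].
  by rewrite lee_fin mulr_ge0// ltW// a0.
rewrite /local_family_sum esum_mkcondr.
have := @esum_ge R _ J (fun S => if S \in [set S | S `<=` P]
   then (a S * \1_S x)%:E else 0) (a P)%:E; apply.
exists [set P]; first by split; [exact: finite_set1|move=> _ ->].
rewrite fsbig_set1 ifT ?inE//=.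
by rewrite indicE mem_set// mulr1.
Qed.

(** Outside [B] the set is empty and the value 1 keeps [al] positive; [fine] is faithful once the
    averages are finite. *)
Let al q i : R := if i \in B then fine (local_average q (e i)) else 1%R.

Section equivalence.
Variables q r tau : R.
Hypothesis q0 : (0 < q)%R.
Hypothesis qr : (q < r)%R.
Hypothesis tau0 : (0 < tau)%R.

Let F := family_sum J a.
Let sx := (q^-1 * (r / tau - 1))%R.
Let G x := \esum_(P in J) ((a P * \1_P x)%:E * local_average q P `^ sx).

Let r0 : (0 < r)%R. Proof. exact: lt_trans qr. Qed.

Let F_wsum x : F x = wsum lam Q x.
Proof. by rewrite /F family_sum_wsum// => P /a0/ltW. Qed.

Let term0 P x : J P -> 0 <= (a P * \1_P x)%:E * local_average q P `^ sx.
Proof.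
by move=> JP; rewrite mule_ge0 ?poweR_ge0// lee_fin mulr_ge0// ltW// a0.
Qed.

Let F0 x : 0 <= F x.
Proof. by rewrite F_wsum wsum_ge0. Qed.

Let mF p : measurable_fun [set: X] (fun x => F x `^ p).
Proof.
rewrite (_ : (fun x => _) = (fun x => wsum lam Q x `^ p)).
  exact: measurable_wsum_poweR.
by apply/funext => x; rewrite F_wsum.
Qed.

Let mG : measurable_fun [set: X] (fun x => G x `^ tau).
Proof.
apply: (@measurableT_comp _ _ _ _ _ _ (fun y : \bar R => y `^ tau)).
  exact: measurable_poweR.
rewrite (_ : G = fun x => \sum_(i <oo) (if i \in B then
    (a (e i) * \1_(e i) x)%:E * local_average q (e i) `^ sx else 0)).
  apply: ge0_emeasurable_sum => [i x _ _|i _].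
    by case: ifPn => // /eB; exact: term0.
  have [iB|_] := boolP (i \in B); last exact: measurable_cst.
  apply: emeasurable_funM => //.
  apply/measurable_EFinP; apply: measurable_funM => //.
  by apply: measurable_indic; exact/mJ/eB.
by apply/funext => x; rewrite /G esum_enum// => P; exact: term0.
Qed.

Let finite_average (fin : forall P, J P -> local_average q P < +oo) :
  \int[mu]_x (G x `^ tau) =
  \int[mu]_x (wsum (fun i => lam i * al q i `^ sx)%R Q x `^ tau) /\
  (forall i, (0 < al q i)%R) /\
  (forall i, (al q i)%:E * mu (Q i) =
    \int[mu]_(x in Q i) (wsum (tail_coef lev lam i) Q x `^ q)).
Proof.
have alE i : i \in B -> (al q i)%:E = local_average q (e i).
  move=> iB; rewrite /al iB fineK// ge0_fin_numE ?fin//; first exact: eB.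
  exact/ltW/local_average_gt0/q0/eB.
split; [|split] => [|i|i].
- apply: eq_integral => x _; congr (_ `^ _).
  rewrite /G esum_enum => [|P]; last exact: term0.
  apply: eq_eseriesr => i _; rewrite /lam /coef /Q.
  case: ifPn => iB; last by rewrite !mul0r.
  by rewrite -alE// poweR_EFin -EFinM mulrAC.
- rewrite -lte_fin; have [iB|iB] := boolP (i \in B).
    by rewrite alE// local_average_gt0//; exact: eB.
  by rewrite /al (negbTE iB).
- have [iB|iB] := boolP (i \in B); last first.
    have -> : Q i = set0 by rewrite /Q (negbTE iB).
    by rewrite measure0 mule0 integral_set0.
  have -> : Q i = e i by rewrite /Q iB.
  rewrite alE// /local_average; have [m [m0 muP ->]] := muV (eB iB).
  rewrite muleAC muP -EFinM mulVf ?gt_eqF// mul1e.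
  by apply: eq_integral => x; rewrite inE => ix; rewrite local_family_sum_tail.
Qed.

(* [F ^ q <= 1 + F ^ r] and [mu P] is finite. *)
Let infinite_average P : J P -> local_average q P = +oo ->
  \int[mu]_x (F x `^ r) = +oo /\
  (sx != 0%R -> \int[mu]_x (G x `^ tau) = +oo).
Proof.
move=> JP avgP; have [m [m0 muP muPV]] := muV JP.
have mP := mJ JP.
split=> [|sx0].
  have : \int[mu]_(x in P) (local_family_sum P x `^ q) = +oo.
    move: avgP; rewrite /local_average muPV.
    case: (\int[mu]_(x in P) _) => [s|//|].
      by rewrite -EFinM.
    by rewrite gt0_muleNy// lte_fin invr_gt0.
  move=> intP; apply/eqP; rewrite -leye_eq -intP.
  have [i iB eP] : exists2 i, i \in B & e i = P.
    by move: (JP); rewrite -eJ => -[i Bi <-]; exists i => //; rewrite inE.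
  have le1 : \int[mu]_(x in P) (local_family_sum P x `^ q) <=
      \int[mu]_(x in P) (1 + F x `^ r).
    apply: ge0_le_integral => //.
    - by move=> x _; exact: poweR_ge0.
    - rewrite -eP; apply: (@eq_measurable_fun _ _ _ _ _
         (fun x => wsum (tail_coef lev lam i) Q x `^ q)).
        by move=> x; rewrite inE => ix; rewrite local_family_sum_tail.
      by apply: measurable_funTS; exact: measurable_wsum_poweR.
    - by apply: emeasurable_funD => //; exact: measurable_funTS.
    move=> x Px; apply: (@le_trans _ _ (F x `^ q)).
      rewrite -eP local_family_sum_tail ?eP// F_wsum.
      apply: gt0_ler_poweR; first exact: ltW.
      + by rewrite in_itv/= leey wsum_ge0.
      + by rewrite in_itv/= leey wsum_ge0.
      by apply: le_wsum => // j; rewrite /tail_coef; case: ifP.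
    case: (F x) (F0 x) => [y y0|_|//]; last by rewrite !eqy_poweR// addey.
    rewrite !poweR_EFin -EFinD lee_fin; rewrite lee_fin in y0.
    have [y1|y1] := lerP y 1%R.
      apply: (@le_trans _ _ 1%R); last by rewrite lerDl powR_ge0.
      apply: (@le_trans _ _ (1 `^ q)%R); last by rewrite powR1.
      by rewrite ge0_ler_powR ?nnegrE// ltW.
    apply: (@le_trans _ _ (y `^ r)%R); last by rewrite lerDr.
    by rewrite ler_powR// ltW.
  move: le1; rewrite intP leye_eq ge0_integralD//; last 2 first.
  - by move=> x _; exact: poweR_ge0.
  - exact: measurable_funTS.
  rewrite integral_cst// mul1e muP => /eqP H.
  have : \int[mu]_(x in P) (F x `^ r) = +oo.
    by move: H; case: (\int[mu]_(x in P) _).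
  move=> <-; apply: ge0_subset_integral => //.
  by move=> x _; exact: poweR_ge0.
(* Any nonzero power of [+oo], also a negative one, is [+oo], so the term of [P] alone makes [G]
   infinite on a set of positive measure. *)
have GP x : P x -> G x = +oo.
  move=> Px; apply/eqP; rewrite -leye_eq /G.
  apply: esum_ge; exists [set P].
    by split; [exact: finite_set1|move=> _ ->].
  rewrite fsbig_set1 avgP poweRyr// indicE mem_set// mulr1 gt0_muley//.
  by rewrite lte_fin a0.
apply/eqP; rewrite -leye_eq.
apply: (@le_trans _ _ (\int[mu]_(x in P) (G x `^ tau))); last first.
  apply: ge0_subset_integral => //.
  by move=> x _; exact: poweR_ge0.
rewrite (eq_integral (fun=> +oo)).
  by rewrite integral_cst// muP gt0_mulye// lte_fin.
by move=> x; rewrite inE => Px; rewrite GP// eqy_poweR.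
Qed.

Lemma family_equivalence :
  \int[mu]_x (G x `^ tau) <=
    (equivalence_const q r tau)%:E * \int[mu]_x (F x `^ r) /\
  \int[mu]_x (F x `^ r) <=
    (equivalence_const q r tau)%:E * \int[mu]_x (G x `^ tau).
Proof.
have [C1 C2 C3 C4 C5] := equivalence_const_ge q r0 tau0.
set C := equivalence_const q r tau in C1 C2 C3 C4 C5 *.
have C0 : (0 < C)%R by exact: lt_le_trans C1.
have IF0 : 0 <= \int[mu]_x (F x `^ r).
  by apply: integral_ge0 => x _; exact: poweR_ge0.
have IG0 : 0 <= \int[mu]_x (G x `^ tau).
  by apply: integral_ge0 => x _; exact: poweR_ge0.
(* For [r = tau] the exponent [sx] is 0 and the two integrals coincide. *)
have [rtau|rtau] := eqVneq r tau.
  have -> : \int[mu]_x (G x `^ tau) = \int[mu]_x (F x `^ r).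
    rewrite rtau; apply: eq_integral => x _; congr (_ `^ _).
    apply: eq_esum => P _.
    by rewrite /sx rtau divff ?gt_eqF// subrr mulr0 poweRe0 mule1.
  by split; apply: lee_pemull => //; rewrite lee_fin.
have sx0 : sx != 0%R.
  rewrite mulf_eq0 invr_eq0 (gt_eqF q0)/= subr_eq0.
  apply: contra rtau => /eqP H.
  by rewrite -(divfK (lt0r_neq0 tau0) r) H mul1r.
(* One infinite average makes both integrals infinite; otherwise all averages are positive reals and
   the four bounds apply. *)
have [[P JP avgP]|fin] := pselect (exists2 P, J P & local_average q P = +oo).
  have [-> /(_ sx0) ->] := infinite_average JP avgP.
  by rewrite gt0_muley ?lte_fin.
have [|GE [al0 alE]] := finite_average.
  move=> P JP; rewrite ltey; apply/eqP => avgP.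
  by apply: fin; exists P.
rewrite GE in IG0 *.
have FE : \int[mu]_x (F x `^ r) = \int[mu]_x (wsum lam Q x `^ r).
  by apply: eq_integral => x _; rewrite F_wsum.
rewrite FE in IF0 *.
have weaken (c : R) (y z : \bar R) : (c <= C)%R -> 0 <= z ->
    y <= c%:E * z -> y <= C%:E * z.
  by move=> cC z0 yz; apply: (le_trans yz); rewrite lee_wpmul2r ?lee_fin.
have [lt|gt|//] := ltgtP r tau; last by move=> E; rewrite E eqxx in rtau.
  split.
    apply: (weaken _ _ _ C4 IF0).
    by apply: (upper_bound_neg Qlev) => //; rewrite r0.
  apply: (weaken _ _ _ C5 IG0).
  exact: (lower_bound_neg Qlev).
split.
  apply: (weaken _ _ _ C2 IF0).
  by apply: (upper_bound_pos Qlev) => //; rewrite tau0.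
apply: (weaken _ _ _ C3 IG0).
by apply: (lower_bound_pos Qlev) => //; rewrite tau0.
Qed.

End equivalence.

End laminar_families.

Lemma countable_enumeration (T : pointedType) (J : set T) : countable J ->
  exists (B : set nat) (e : nat -> T), set_inj B e /\ e @` B = J.
Proof.
move=> /countable_bijP[B /card_esym/card_set_bijP[e [e1 e2 e3]]].
by exists B, e; split => //; apply/seteqP; split => // Q [i Bi <-]; exact: e1.
Qed.

(** * The equivalence *)

Lemma esum_subset (R : realType) (T : choiceType) (I J : set T)
    (h : T -> \bar R) : J `<=` I -> (forall i, I i -> ~ J i -> h i = 0%E) ->
  (\esum_(i in I) h i = \esum_(i in J) h i)%E.
Proof.
move=> JI h0; rewrite -[in RHS](setIidr JI) esum_mkcondr.
apply: eq_esum => i Ii; case: ifPn => // iJ; apply: h0 => // Ji.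
by move/negP: iJ; apply; rewrite inE.
Qed.

Unset Implicit Arguments.

(* C is chosen before n and sigma: it depends only on r, q and tau. *)
Theorem theorem3p2 (R : realType) (q r tau : R)
    (hq : 0 < q) (hqr : q < r) (htau : 0 < tau) :
  exists2 C : R, 0 < C &
    forall (n : nat) (sigma : {measure set (borelRn R n) -> \bar R})
           (lam : set (borelRn R n) -> R),
      (0 < n)%N ->
      locally_finite sigma ->
      (forall Q, dyadic_cubes Q -> 0 <= lam Q) ->
      ((C^-1)%:E * a2 sigma lam q r tau <= a1 sigma lam r)%E /\
      (a1 sigma lam r <= C%:E * a2 sigma lam q r tau)%E.
Proof.
have r0 : 0 < r by exact: lt_trans hqr.
have [C1 _ _ _ _] := equivalence_const_ge q r0 htau.
have C0 : 0 < equivalence_const q r tau by exact: lt_le_trans C1.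
exists (equivalence_const q r tau) => // n sigma lam _ lf lam_ge0.
(* Cubes with zero coefficient contribute to no sum; discarding them makes all remaining averages
   positive. *)
pose J := [set Q | charged_cubes sigma Q /\ 0 < lam Q].
have JD Q : J Q -> dyadic_cubes Q by move=> [[]].
have JC : J `<=` charged_cubes sigma by move=> Q [].
have lamJ Q : charged_cubes sigma Q -> ~ J Q -> lam Q = 0.
  move=> cQ nJQ; apply/eqP; rewrite eq_le lam_ge0 ?andbT; last by case: cQ.
  by rewrite leNgt; apply/negP => lamQ; apply: nJQ.
have cJ : countable J.
  apply: (card_le_trans _ (@countable_dyadic_cubes R n)).
  exact/subset_card_le.
have avgE P : average_pow sigma lam q P = local_average sigma J lam q P.
  rewrite /average_pow /local_average; congr (_ * _)%E.
  apply: eq_integral => x _; congr (_ `^ _)%E.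
  apply: esum_subset => [Q [JQ QP]|Q [cQ QP] nJQ]; first by split=> //; exact: JC.
  by rewrite lamJ ?mul0r// => JQ; apply: nJQ.
have a1E : a1 sigma lam r = (\int[sigma]_x (family_sum J lam x `^ r))%E.
  apply: eq_integral => x _; congr (_ `^ _)%E; apply: esum_subset => // Q cQ nJQ.
  by rewrite lamJ ?mul0r.
have a2E : a2 sigma lam q r tau = (\int[sigma]_x ((\esum_(P in J)
    ((lam P * \1_P x)%:E * local_average sigma J lam q P
      `^ (q^-1 * (r / tau - 1))%R)) `^ tau))%E.
  apply: eq_integral => x _; apply: (congr1 (poweR^~ tau)).
  transitivity (\esum_(P in J) ((lam P * \1_P x)%:E *
      average_pow sigma lam q P `^ (q^-1 * (r / tau - 1))%R))%E.
    by apply: esum_subset => // Q cQ nJQ; rewrite lamJ// mul0r mul0e.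
  by apply: eq_esum => P _; rewrite avgE.
have [B [e [einj eJ]]] := countable_enumeration cJ.
have [le21 le12] := @family_equivalence _ _ _ sigma J (@dyadic_level R n) lam
  (fun Q JQ => measurable_dyadic_cube (JD Q JQ))
  (fun Q JQ => locally_finite_dyadic_cube lf (JD Q JQ))
  (fun Q JQ => (JC Q JQ).2)
  (fun P Q x JP JQ => @dyadic_nested R n P Q x (JD P JP) (JD Q JQ))
  (fun P Q x JP JQ => @dyadic_eq R n P Q x (JD P JP) (JD Q JQ))
  (fun Q JQ => JQ.2) B e einj eJ q r tau hq hqr htau.
rewrite a1E a2E; split; last exact: le12.
by rewrite lee_pdivrMl//; exact: le21.
Qed.
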